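(* Let $0<\alpha<1$ and $\xi\in\mathbb{R}$, and for $1<\tau<2$ define $$T_s:=\frac{\sin\pi(1-\tau+\alpha-i\xi)}{\sin\pi(1-\tau+2\alpha-i\xi)},\qquad T_B:=\frac{\sin\pi\alpha}{\pi}\,B(\tau-2\alpha+1+i\xi,2\alpha).$$ (a) If $\xi=0$ and $1<\tau<2$, then there exists a unique $\alpha_c$ such that $T_s=T_B$ exactly when $\tau=1+\alpha_c$. (b) If $\xi\ge\tfrac14$ and $1+\alpha\le\tau<2$, then $|T_s|>|T_B|$. (c) If $0<\xi<\tfrac14$ and $1+\alpha\le\tau<2$, then $\arg T_s\ne\arg T_B$. (d) If $\xi>0$ and $1<\tau<1+\alpha$, then $\arg T_s\ne\arg T_B$. Consequently, for given $0<\alpha<1$, the equation $T_s=T_B$ has a unique solution $(\tau,\xi)$ with $1<\tau<2$, $\xi\in\mathbb{R}$, namely $\xi=0$, $\tau=1+\alpha_c$; in particular for $\xi\ne0$ there are no solutions with $1<\tau<2$.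
   Context: $B(a,b)=\Gamma(a)\Gamma(b)/\Gamma(a+b)$ is the Beta function extended to complex arguments. $\arg$ denotes the principal argument, with values in $(-\pi,\pi]$. For $\xi=0$ the equation $T_s=T_B$ is equivalent to $\Gamma(2\alpha-\tau)\Gamma(\tau+1)\sin\pi(\alpha-\tau)=\Gamma(2\alpha)\sin\pi\alpha$. *)

(* Defs.v *)
From Stdlib Require Import Reals Factorial.
From Coquelicot Require Import Coquelicot.
Open Scope R_scope.

Definition Cexp (z : C) : C :=
  (exp (Re z) * cos (Im z), exp (Re z) * sin (Im z)).

Definition Csin (z : C) : C :=
  (sin (Re z) * cosh (Im z), cos (Re z) * sinh (Im z)).

Definition Cnatpow (n : nat) (z : C) : C := Cexp (Cmult z (RtoC (ln (INR n)))).

Fixpoint Cpoch (z : C) (n : nat) : C :=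
  match n with
  | O => z
  | S m => Cmult (Cpoch z m) (Cplus z (RtoC (INR (S m))))
  end.

(* Gauss's product: Gamma z = lim_{n->oo} n! n^z / (z (z+1) ... (z+n)) *)
Definition gauss_seq (z : C) (n : nat) : C :=
  Cdiv (Cmult (RtoC (INR (Factorial.fact n))) (Cnatpow n z)) (Cpoch z n).

(* Complex Gamma function (valid for z not in {0,-1,-2,...}),
   defined as the limit of Gauss's sequence, componentwise. *)
Definition CGamma (z : C) : C :=
  (real (Lim_seq (fun n => Re (gauss_seq z n))),
   real (Lim_seq (fun n => Im (gauss_seq z n)))).

Definition CBeta (a b : C) : C :=
  Cdiv (Cmult (CGamma a) (CGamma b)) (CGamma (Cplus a b)).

(* principal argument, values in (-PI, PI]; Carg 0 = 0 (unused here) *)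
Definition Carg (z : C) : R :=
  let x := Re z in let y := Im z in
  match Rlt_dec 0 x with
  | left _ => atan (y / x)
  | right _ =>
    match Rlt_dec x 0 with
    | left _ => if Rle_dec 0 y then atan (y / x) + PI else atan (y / x) - PI
    | right _ =>
      match Rlt_dec 0 y with
      | left _ => PI / 2
      | right _ => if Rlt_dec y 0 then - (PI / 2) else 0
      end
    end
  end.

Definition T_s (alpha tau xi : R) : C :=
  Cdiv (Csin (Cmult (RtoC PI) (1 - tau + alpha, - xi)))
       (Csin (Cmult (RtoC PI) (1 - tau + 2 * alpha, - xi))).

Definition T_B (alpha tau xi : R) : C :=
  Cmult (RtoC (sin (PI * alpha) / PI))
        (CBeta (tau - 2 * alpha + 1, xi) (RtoC (2 * alpha))).

(* Main.v *)
Require Import Defs.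
From Stdlib Require Import Reals Factorial Lra Lia Psatz.
From Coquelicot Require Import Coquelicot.
Open Scope R_scope.

(** Write s = tau + i xi.  Gauss's product gives modulus and argument of Gamma as
    limits of explicit real sequences.  On the real axis the solution is located in
    max(1, 2 alpha) < tau < 1 + alpha; there T_s exp(2 alpha tau) strictly decreases
    while T_B exp(2 alpha tau) does not, so the crossing is unique.  For (b),
    |T_B| <= sin(pi alpha) / (2 pi alpha) < 1/2 <= tanh(pi xi) <= |T_s|.

    Off the axis, Euler's sine product turns arg T_s into a sum of terms
    theta(u) - theta(u + alpha), where theta(u) is the argument of u + i xi.  After
    cancelling the common terms with the product for T_B, arg T_B - arg T_s is a series
    whose terms compare the drop of theta over two windows of width alpha.  Since
    theta' is even and unimodal, the drop is larger over the window centred nearer to 0,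
    so all terms are positive; the total telescopes below pi.  Hence the arguments
    differ for every xi > 0 and 1 < tau < 2, and xi < 0 follows by conjugation. *)

(** Principal arguments do not add, so no argument is reduced modulo 2 pi: [lgarg] and [sine_arg]
    are plain real sums of angles. The final comparison only needs a difference E with 0 < E < pi,
    because sin E > 0 whatever multiples of 2 pi have been lost. A truncated sine product does not
    have the argument of the sine. The integrals behind Euler's product supply its remainder as an
    explicit factor tending to 1, so that the finite identity is exact and the limit can be taken
    along rays, without continuity of the argument. On the real axis the exponent 2 alpha is a
    Lipschitz constant in tau for ln B(tau - 2 alpha + 1, 2 alpha) once tau >= max(1, 2 alpha); the
    sine quotient falls steeply enough to absorb it. *)

(** * Elementary inequalities and a convergence criterion *)

Lemma mean_value (f df : R -> R) (a b : R) :
  a < b -> (forall c, a <= c <= b -> is_derive f c (df c)) ->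
  exists c, a < c < b /\ f b - f a = df c * (b - a).
Proof.
  intros Hab Hd.
  destruct (MVT_cor2 f df a b Hab) as [c [Hc1 Hc2]].
  - intros c Hc; apply is_derive_Reals, Hd, Hc.
  - exists c; tauto.
Qed.

Lemma exp_le_exp (x y : R) : x <= y -> exp x <= exp y.
Proof.
  intros [H | ->]; [left; now apply exp_increasing | apply Rle_refl].
Qed.

Lemma ln_le_sub_1 (x : R) : 0 < x -> ln x <= x - 1.
Proof.
  intros Hx.
  assert (H := exp_ineq1_le (ln x)).
  rewrite exp_ln in H; lra.
Qed.

Lemma ln_ge_1_sub_inv (x : R) : 0 < x -> 1 - / x <= ln x.
Proof.
  intros Hx.
  assert (H := ln_le_sub_1 (/ x) (Rinv_0_lt_compat _ Hx)).
  rewrite ln_Rinv in H; lra.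
Qed.

Lemma atan_le_id (u : R) : 0 <= u -> atan u <= u.
Proof.
  intros [H | <-]; [| rewrite atan_0; lra].
  destruct (mean_value atan (fun x => / (1 + x²)) 0 u H) as [c [Hc E]].
  - intros c _; apply is_derive_atan.
  - rewrite atan_0 in E.
    assert (/ (1 + c²) <= 1); [| nra].
    rewrite <- Rinv_1; apply Rinv_le_contravar; unfold Rsqr; nra.
Qed.

Lemma atan_ge_sub_sqr (u : R) : 0 <= u -> u - u ^ 2 <= atan u.
Proof.
  intros [H | <-]; [| rewrite atan_0; lra].
  destruct (mean_value atan (fun x => / (1 + x²)) 0 u H) as [c [Hc E]].
  - intros c _; apply is_derive_atan.
  - rewrite atan_0 in E.
    assert (Hd : 1 - u <= / (1 + c²)); [| nra].
    apply Rmult_le_reg_r with (1 + c²); [unfold Rsqr; nra |].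
    rewrite Rinv_l by (unfold Rsqr; nra).
    unfold Rsqr.
    destruct (Rle_or_lt 1 u); nra.
Qed.

(** Since K / (n (n + 1)) = K / n - K / (n + 1), the sequence u n - K / n increases while u n + K /
    n decreases, and they differ by 2 K / n. Starting at n = 1 avoids division by 0 and, in the
    applications, the default value of ln 0. *)
Lemma ex_finite_lim_seq_telescope (u : nat -> R) (K : R) :
  (forall n, (1 <= n)%nat ->
     Rabs (u (S n) - u n) <= K / (INR n * INR (S n))) ->
  ex_finite_lim_seq u.
Proof.
  intros H.
  assert (Hpos : forall n, 0 < INR (S n)) by (intros; apply lt_0_INR; lia).
  assert (HK : forall n, K / (INR (S n) * INR (S (S n)))
               = K / INR (S n) - K / INR (S (S n))).
  { intros n; rewrite (S_INR (S n)).
    assert (0 < INR (S n)) by apply Hpos. field; lra. }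
  assert (H1 : ex_finite_lim_seq (fun n => u (S n) - K / INR (S n))).
  { apply ex_finite_lim_seq_incr with (M := u 1%nat + K).
    - intros n; specialize (H (S n) ltac:(lia)).
      rewrite HK in H; apply Rabs_le_between in H; lra.
    - assert (Hq : forall n, u (S n) + K / INR (S n) <= u 1%nat + K).
      { induction n as [| n IH]; [simpl; lra |].
        specialize (H (S n) ltac:(lia)).
        rewrite HK in H; apply Rabs_le_between in H; lra. }
      intros n; specialize (Hq n).
      assert (0 <= K).
      { specialize (H 1%nat ltac:(lia)); simpl in H.
        assert (A := Rabs_pos (u 2%nat - u 1%nat)); lra. }
      assert (0 <= K / INR (S n)) by (apply Rdiv_le_0_compat; auto).
      lra. }
  destruct H1 as [l Hl]; exists l.
  apply is_lim_seq_incr_1.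
  apply is_lim_seq_ext with
    (fun n => (u (S n) - K / INR (S n)) + K * / INR (S n)).
  { intros n; unfold Rdiv; ring. }
  replace (Finite l) with (Finite (l + K * 0)) by (f_equal; ring).
  apply is_lim_seq_plus'; [exact Hl |].
  apply (is_lim_seq_scal_l _ K 0).
  apply (is_lim_seq_incr_1 (fun n => / INR n)).
  apply (is_lim_seq_inv INR p_infty).
  - apply is_lim_seq_INR.
  - discriminate.
Qed.

(** * Polar form with unreduced angles *)

Definition polar (r phi : R) : C := (r * cos phi, r * sin phi).

Lemma polar_mult (r s phi psi : R) :
  Cmult (polar r phi) (polar s psi) = polar (r * s) (phi + psi).
Proof.
  unfold polar, Cmult; simpl; rewrite cos_plus, sin_plus; f_equal; ring.
Qed.

Lemma polar_inv (r phi : R) : r <> 0 -> Cinv (polar r phi) = polar (/ r) (- phi).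
Proof.
  intros Hr; unfold polar, Cinv; simpl fst; simpl snd.
  rewrite cos_neg, sin_neg.
  replace ((r * cos phi) ^ 2 + (r * sin phi) ^ 2) with (r * r).
  - f_equal; field; exact Hr.
  - assert (H := sin2_cos2 phi); unfold Rsqr in H.
    transitivity (r * r * (sin phi * sin phi + cos phi * cos phi));
      [rewrite H |]; ring.
Qed.

Lemma polar_div (r s phi psi : R) : s <> 0 ->
  Cdiv (polar r phi) (polar s psi) = polar (r / s) (phi - psi).
Proof.
  intros Hs; unfold Cdiv; rewrite polar_inv, polar_mult by exact Hs; reflexivity.
Qed.

Lemma RtoC_polar (r : R) : RtoC r = polar r 0.
Proof. unfold polar, RtoC; rewrite cos_0, sin_0; f_equal; ring. Qed.

Lemma Cmod_polar (r phi : R) : Cmod (polar r phi) = Rabs r.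
Proof.
  unfold Cmod, polar; simpl fst; simpl snd.
  replace ((r * cos phi) ^ 2 + (r * sin phi) ^ 2) with (Rsqr r);
    [apply sqrt_Rsqr_abs |].
  assert (H := sin2_cos2 phi); unfold Rsqr in *.
  transitivity (r * r * (sin phi * sin phi + cos phi * cos phi));
    [rewrite H |]; ring.
Qed.

(** The modulus is written as an exponential so that products of such factors turn into sums of
    logarithms. *)
Lemma right_half_plane_polar (u xi : R) : 0 < u ->
  (u, xi) = polar (exp (/ 2 * ln (u ^ 2 + xi ^ 2))) (atan (xi / u)).
Proof.
  intros Hu; unfold polar; rewrite cos_atan, sin_atan.
  assert (Hs : 0 < u ^ 2 + xi ^ 2) by nra.
  assert (Hd : sqrt (1 + (xi / u)²) = sqrt (u ^ 2 + xi ^ 2) / u).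
  { replace (1 + (xi / u)²) with ((u ^ 2 + xi ^ 2) / (u ^ 2)).
    - rewrite sqrt_div_alt, sqrt_pow2; [reflexivity | lra | nra].
    - unfold Rsqr; field; lra. }
  assert (He : exp (/ 2 * ln (u ^ 2 + xi ^ 2)) = sqrt (u ^ 2 + xi ^ 2)).
  { change (Rpower (u ^ 2 + xi ^ 2) (/ 2) = sqrt (u ^ 2 + xi ^ 2)).
    now apply Rpower_sqrt. }
  rewrite Hd, He.
  assert (0 < sqrt (u ^ 2 + xi ^ 2)) by (now apply sqrt_lt_R0).
  f_equal; field; lra.
Qed.

(** * Gamma on the right half-plane in polar form *)

Definition lgmod (a xi : R) (n : nat) : R :=
  ln (INR (fact n)) + a * ln (INR n)
  - sum_f_R0 (fun k => / 2 * ln ((a + INR k) ^ 2 + xi ^ 2)) n.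

Definition lgarg (a xi : R) (n : nat) : R :=
  xi * ln (INR n) - sum_f_R0 (fun k => atan (xi / (a + INR k))) n.

Lemma Cpoch_polar (a xi : R) (n : nat) : 0 < a ->
  Cpoch (a, xi) n =
  polar (exp (sum_f_R0 (fun k => / 2 * ln ((a + INR k) ^ 2 + xi ^ 2)) n))
        (sum_f_R0 (fun k => atan (xi / (a + INR k))) n).
Proof.
  intros Ha; induction n as [| n IH].
  - cbn [sum_f_R0 Cpoch INR]; rewrite Rplus_0_r; now apply right_half_plane_polar.
  - change (Cpoch (a, xi) (S n)) with
      (Cmult (Cpoch (a, xi) n) (Cplus (a, xi) (RtoC (INR (S n))))).
    rewrite !tech5, IH.
    assert (0 < INR (S n)) by (apply lt_0_INR; lia).
    replace (Cplus (a, xi) (RtoC (INR (S n)))) with (a + INR (S n), xi)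
      by (unfold Cplus, RtoC; simpl fst; simpl snd; now rewrite Rplus_0_r).
    rewrite (right_half_plane_polar (a + INR (S n)) xi) by lra.
    now rewrite polar_mult, exp_plus.
Qed.

Lemma gauss_seq_polar (a xi : R) (n : nat) : 0 < a ->
  gauss_seq (a, xi) n = polar (exp (lgmod a xi n)) (lgarg a xi n).
Proof.
  intros Ha; unfold gauss_seq; rewrite Cpoch_polar by exact Ha.
  replace (Cnatpow n (a, xi)) with (polar (exp (a * ln (INR n))) (xi * ln (INR n))).
  - rewrite RtoC_polar, polar_mult, polar_div
      by (apply Rgt_not_eq, exp_pos).
    unfold lgmod, lgarg, Rminus.
    rewrite !exp_plus, exp_Ropp, exp_ln by apply INR_fact_lt_0.
    rewrite Rplus_0_l; reflexivity.
  - unfold Cnatpow, Cexp, polar, Cmult, RtoC; simpl.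
    replace (a * ln (INR n) - xi * 0) with (a * ln (INR n)) by ring.
    replace (a * 0 + xi * ln (INR n)) with (xi * ln (INR n)) by ring.
    reflexivity.
Qed.

Lemma ln_succ_div_bounds (n : nat) : (1 <= n)%nat ->
  / INR (S n) <= ln (INR (S n)) - ln (INR n) <= / INR n.
Proof.
  intros Hn.
  assert (H0 : 0 < INR n) by (apply lt_0_INR; lia).
  rewrite S_INR.
  rewrite <- ln_div by lra.
  split.
  - eapply Rle_trans; [| apply ln_ge_1_sub_inv, Rdiv_lt_0_compat; lra].
    right; field; lra.
  - eapply Rle_trans; [apply ln_le_sub_1, Rdiv_lt_0_compat; lra |].
    right; field; lra.
Qed.

(** With x = n, an increment is a ln((x + 1) / x) minus half the logarithm of ((a + x + 1)^2 + xi^2)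
    / (x + 1)^2. Both are a / x up to O(1 / x^2), so they differ by a telescoping bound. *)
Lemma lgmod_cv (a xi : R) : 0 < a -> ex_finite_lim_seq (lgmod a xi).
Proof.
  intros Ha.
  apply ex_finite_lim_seq_telescope with (a ^ 2 + a + xi ^ 2).
  intros n Hn; unfold lgmod; rewrite tech5.
  assert (Hl := ln_succ_div_bounds n Hn).
  assert (H0 : 1 <= INR n) by (apply (le_INR 1); lia).
  replace (ln (INR (fact (S n)))) with (ln (INR (S n)) + ln (INR (fact n))).
  2: { change (fact (S n)) with (S n * fact n)%nat.
       rewrite mult_INR, ln_mult; [reflexivity | apply lt_0_INR; lia | apply INR_fact_lt_0]. }
  rewrite S_INR in *; set (x := INR n) in *.
  set (d := ln (x + 1) - ln x) in *.
  match goal with |- Rabs ?e <= _ =>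
    replace e with (a * d - / 2 * (ln ((a + (x + 1)) ^ 2 + xi ^ 2) - 2 * ln (x + 1)))
      by (unfold d; field) end.
  replace (2 * ln (x + 1)) with (ln ((x + 1) ^ 2))
    by (simpl; rewrite Rmult_1_r, ln_mult; lra).
  rewrite <- ln_div by nra.
  set (y := ((a + (x + 1)) ^ 2 + xi ^ 2) / (x + 1) ^ 2).
  assert (Hy : 0 < y) by (apply Rdiv_lt_0_compat; nra).
  assert (U : ln y <= y - 1) by now apply ln_le_sub_1.
  (* Dropping xi^2 from the numerator of [y] leaves a perfect square. *)
  assert (L : 2 * (a / (a + (x + 1))) <= ln y).
  { apply Rle_trans with (ln (((a + (x + 1)) / (x + 1)) ^ 2)).
    - simpl; rewrite Rmult_1_r, ln_mult by (apply Rdiv_lt_0_compat; lra).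
      assert (A := ln_ge_1_sub_inv ((a + (x + 1)) / (x + 1))
                     ltac:(apply Rdiv_lt_0_compat; lra)).
      replace (1 - / ((a + (x + 1)) / (x + 1))) with (a / (a + (x + 1))) in A
        by (field; lra).
      lra.
    - apply ln_le; [apply pow_lt, Rdiv_lt_0_compat; lra |].
      unfold y; replace (((a + (x + 1)) / (x + 1)) ^ 2)
        with ((a + (x + 1)) ^ 2 / (x + 1) ^ 2) by (field; lra).
      apply Rmult_le_compat_r; [left; apply Rinv_0_lt_compat; nra | nra]. }
  assert (Hx : 0 < x * (x + 1)) by nra.
  assert (E1 : a / x - a / (a + (x + 1)) <= (a ^ 2 + a) / (x * (x + 1))).
  { replace (a / x - a / (a + (x + 1))) with ((a ^ 2 + a) / (x * (a + (x + 1))))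
      by (field; lra).
    apply Rmult_le_compat_l; [nra | apply Rinv_le_contravar; nra]. }
  assert (E2 : / 2 * (y - 1) - a / (x + 1) <= (a ^ 2 + xi ^ 2) / (x * (x + 1))).
  { replace (/ 2 * (y - 1) - a / (x + 1)) with ((a ^ 2 + xi ^ 2) / (2 * (x + 1) ^ 2))
      by (unfold y; field; lra).
    apply Rmult_le_compat_l; [nra | apply Rinv_le_contravar; nra]. }
  assert (P1 : 0 <= a / (x * (x + 1))) by (apply Rdiv_le_0_compat; lra).
  assert (P2 : 0 <= xi ^ 2 / (x * (x + 1))) by (apply Rdiv_le_0_compat; nra).
  unfold Rdiv in *; rewrite !Rmult_plus_distr_r in *.
  assert (a * d <= a * / x) by nra.
  assert (a * / (x + 1) <= a * d) by nra.
  apply Rabs_le; split; lra.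
Qed.

(** Both xi ln((n + 1) / n) and atan(xi / (a + n + 1)) are xi / n up to O(1 / n^2). Negative xi is
    reached later by conjugation. *)
Lemma lgarg_cv (a xi : R) : 0 < a -> 0 <= xi -> ex_finite_lim_seq (lgarg a xi).
Proof.
  intros Ha Hxi.
  apply ex_finite_lim_seq_telescope with (xi * (a + 1) + xi ^ 2).
  intros n Hn; unfold lgarg; rewrite tech5.
  assert (Hl := ln_succ_div_bounds n Hn).
  assert (H0 : 1 <= INR n) by (apply (le_INR 1); lia).
  rewrite S_INR in *; set (x := INR n) in *.
  set (d := ln (x + 1) - ln x) in *.
  match goal with |- Rabs ?e <= _ =>
    replace e with (xi * d - atan (xi / (a + (x + 1)))) by (unfold d; ring) end.
  set (u := xi / (a + (x + 1))).
  assert (Hu : 0 <= u) by (apply Rdiv_le_0_compat; lra).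
  assert (A1 := atan_le_id u Hu).
  assert (A2 := atan_ge_sub_sqr u Hu).
  assert (B1 : xi * d <= xi / x) by (apply Rmult_le_compat_l; lra).
  assert (B2 : xi / (x + 1) <= xi * d) by (apply Rmult_le_compat_l; lra).
  assert (B3 : u <= xi / (x + 1)).
  { apply Rmult_le_compat_l; [lra | apply Rinv_le_contravar; lra]. }
  assert (Hx : 0 < x * (x + 1)) by nra.
  assert (E1 : xi / x - u <= xi * (a + 1) / (x * (x + 1))).
  { replace (xi / x - u) with (xi * (a + 1) / (x * (a + (x + 1))))
      by (unfold u; field; lra).
    apply Rmult_le_compat_l; [nra | apply Rinv_le_contravar; nra]. }
  assert (E2 : u ^ 2 <= xi ^ 2 / (x * (x + 1))).
  { replace (u ^ 2) with (xi ^ 2 / (a + (x + 1)) ^ 2) by (unfold u; field; lra).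
    apply Rmult_le_compat_l; [nra | apply Rinv_le_contravar; nra]. }
  replace ((xi * (a + 1) + xi ^ 2) / (x * (x + 1))) with
    (xi * (a + 1) / (x * (x + 1)) + xi ^ 2 / (x * (x + 1))) by (field; lra).
  rewrite Rabs_pos_eq; lra.
Qed.

Definition lnGamma (a xi : R) : R := real (Lim_seq (lgmod a xi)).
Definition argGamma (a xi : R) : R := real (Lim_seq (lgarg a xi)).

Lemma is_lim_lgmod (a xi : R) : 0 < a -> is_lim_seq (lgmod a xi) (lnGamma a xi).
Proof. intros; now apply Lim_seq_correct', lgmod_cv. Qed.

Lemma is_lim_lgarg (a xi : R) : 0 < a -> 0 <= xi ->
  is_lim_seq (lgarg a xi) (argGamma a xi).
Proof. intros; now apply Lim_seq_correct', lgarg_cv. Qed.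

Lemma is_lim_seq_cos (u : nat -> R) (l : R) :
  is_lim_seq u l -> is_lim_seq (fun n => cos (u n)) (cos l).
Proof. apply is_lim_seq_continuous, continuity_cos. Qed.

Lemma is_lim_seq_sin (u : nat -> R) (l : R) :
  is_lim_seq u l -> is_lim_seq (fun n => sin (u n)) (sin l).
Proof. apply is_lim_seq_continuous, continuity_sin. Qed.

Lemma is_lim_seq_exp (u : nat -> R) (l : R) :
  is_lim_seq u l -> is_lim_seq (fun n => exp (u n)) (exp l).
Proof. apply is_lim_seq_continuous, derivable_continuous_pt, derivable_pt_exp. Qed.

Lemma CGamma_polar (a xi : R) : 0 < a -> 0 <= xi ->
  CGamma (a, xi) = polar (exp (lnGamma a xi)) (argGamma a xi).
Proof.
  intros Ha Hxi.
  assert (Hm := is_lim_seq_exp _ _ (is_lim_lgmod a xi Ha)).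
  assert (Hp := is_lim_lgarg a xi Ha Hxi).
  unfold CGamma, polar; f_equal.
  - rewrite (is_lim_seq_unique _ (exp (lnGamma a xi) * cos (argGamma a xi)));
      [reflexivity |].
    eapply is_lim_seq_ext; [| apply (is_lim_seq_mult' _ _ _ _ Hm (is_lim_seq_cos _ _ Hp))].
    intros n; now rewrite gauss_seq_polar by exact Ha.
  - rewrite (is_lim_seq_unique _ (exp (lnGamma a xi) * sin (argGamma a xi)));
      [reflexivity |].
    eapply is_lim_seq_ext; [| apply (is_lim_seq_mult' _ _ _ _ Hm (is_lim_seq_sin _ _ Hp))].
    intros n; now rewrite gauss_seq_polar by exact Ha.
Qed.

Lemma is_lim_seq_ln (u : nat -> R) (l : R) : 0 < l ->
  is_lim_seq u l -> is_lim_seq (fun n => ln (u n)) (ln l).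
Proof.
  intros Hl; apply is_lim_seq_continuous, derivable_continuous_pt.
  exists (/ l); now apply derivable_pt_lim_ln.
Qed.

(** * Comparison of log-Gamma differences *)

Lemma half_ln_sqr (u : R) : 0 < u -> / 2 * ln (u ^ 2 + 0 ^ 2) = ln u.
Proof.
  intros Hu; replace (u ^ 2 + 0 ^ 2) with (u * u) by ring.
  rewrite ln_mult by exact Hu; field.
Qed.

Lemma is_lim_lnGamma_sub (x b xi : R) : 0 < x -> 0 <= b ->
  is_lim_seq (fun n =>
    sum_f_R0 (fun k => / 2 * ln ((x + b + INR k) ^ 2 + xi ^ 2)
                       - / 2 * ln ((x + INR k) ^ 2 + xi ^ 2)) n - b * ln (INR n))
    (lnGamma x xi - lnGamma (x + b) xi).
Proof.
  intros Hx Hb.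
  eapply is_lim_seq_ext;
    [| apply is_lim_seq_minus'; apply is_lim_lgmod; lra].
  intros n; unfold lgmod; rewrite minus_sum; ring.
Qed.

(** The normalising term b ln n depends on the shift [b] alone, so two Gamma quotients with the same
    shift can be compared through their partial sums. *)
Lemma lnGamma_sub_le_of_sum (x b xi y eta K : R) :
  0 < x -> 0 <= b -> 0 < y ->
  (forall n,
    sum_f_R0 (fun k => / 2 * ln ((x + b + INR k) ^ 2 + xi ^ 2)
                       - / 2 * ln ((x + INR k) ^ 2 + xi ^ 2)) n <=
    sum_f_R0 (fun k => / 2 * ln ((y + b + INR k) ^ 2 + eta ^ 2)
                       - / 2 * ln ((y + INR k) ^ 2 + eta ^ 2)) n + K) ->
  lnGamma x xi - lnGamma (x + b) xi <= lnGamma y eta - lnGamma (y + b) eta + K.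
Proof.
  intros Hx Hb Hy H.
  apply (is_lim_seq_le _ _ (Finite _) (Finite _)) with
    (2 := is_lim_lnGamma_sub x b xi Hx Hb)
    (3 := is_lim_seq_plus' _ _ _ _ (is_lim_lnGamma_sub y b eta Hy Hb)
            (is_lim_seq_const K)).
  intros n; specialize (H n); simpl in *; lra.
Qed.

(** Adding xi^2 to numerator and denominator of (X + b)^2 / X^2, a fraction at least 1, can only
    lower it. *)
Lemma lnGamma_sub_le_real (x b xi : R) : 0 < x -> 0 <= b ->
  lnGamma x xi - lnGamma (x + b) xi <= lnGamma x 0 - lnGamma (x + b) 0.
Proof.
  intros Hx Hb; rewrite <- (Rplus_0_r (_ - lnGamma (x + b) 0)).
  apply lnGamma_sub_le_of_sum; auto; intros n.
  rewrite Rplus_0_r; apply sum_growing; intros k.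
  assert (Hk := pos_INR k).
  set (X := x + INR k); replace (x + b + INR k) with (X + b) by (unfold X; ring).
  assert (HX : 0 < X) by (unfold X; lra).
  rewrite <- !Rmult_minus_distr_l.
  apply Rmult_le_compat_l; [lra |].
  assert (0 < X * X) by nra.
  assert (0 < (X + b) ^ 2 + xi ^ 2) by nra.
  assert (0 < X ^ 2 + xi ^ 2) by nra.
  assert (0 < (X + b) ^ 2 + 0 ^ 2) by nra.
  assert (0 < X ^ 2 + 0 ^ 2) by nra.
  rewrite <- !ln_div by assumption.
  apply ln_le; [now apply Rdiv_lt_0_compat |].
  apply Rle_div_l; [assumption |].
  replace (((X + b) ^ 2 + 0 ^ 2) / (X ^ 2 + 0 ^ 2) * (X ^ 2 + xi ^ 2))
    with ((X + b) ^ 2 + xi ^ 2 * ((X + b) ^ 2 / X ^ 2)) by (field; lra).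
  assert (1 <= (X + b) ^ 2 / X ^ 2).
  { apply Rle_div_r; nra. }
  assert (0 <= xi ^ 2) by nra. nra.
Qed.

Lemma lnGamma_sub_decr (x y b : R) : 0 < x <= y -> 0 <= b ->
  lnGamma y 0 - lnGamma (y + b) 0 <= lnGamma x 0 - lnGamma (x + b) 0.
Proof.
  intros [Hx Hy] Hb; rewrite <- (Rplus_0_r (_ - lnGamma (x + b) 0)).
  apply lnGamma_sub_le_of_sum; auto; [lra |]; intros n.
  rewrite Rplus_0_r; apply sum_growing; intros k.
  assert (Hk := pos_INR k).
  rewrite !half_ln_sqr by lra.
  rewrite <- !ln_div by lra.
  apply ln_le; [apply Rdiv_lt_0_compat; lra |].
  replace ((y + b + INR k) / (y + INR k)) with (1 + b * / (y + INR k)) by (field; lra).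
  replace ((x + b + INR k) / (x + INR k)) with (1 + b * / (x + INR k)) by (field; lra).
  apply Rplus_le_compat_l, Rmult_le_compat_l; [lra | apply Rinv_le_contravar; lra].
Qed.

(** The k-th terms differ by at most b (Y - X) / (X (Y + b)), where X >= k + 1 and Y + b >= k + 2.
    The sum of 1 / ((k + 1) (k + 2)) telescopes to at most 1, which leaves the constant [b]. *)
Lemma lnGamma_sub_lipschitz (x y b : R) : 1 <= x <= y -> 0 <= b -> 2 <= x + b ->
  lnGamma x 0 - lnGamma (x + b) 0 <= lnGamma y 0 - lnGamma (y + b) 0 + b * (y - x).
Proof.
  intros [Hx Hy] Hb Hxb.
  apply lnGamma_sub_le_of_sum; auto; [lra | lra |]; intros n.
  assert (Hn : forall n, sum_f_R0 (fun k => / ((INR k + 1) * (INR k + 2))) n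
                    = 1 - / (INR n + 2)).
  { clear n; induction n as [| n IH]; [simpl; field |].
    rewrite tech5, IH, S_INR.
    assert (Hk := pos_INR n); field; lra. }
  apply Rle_trans with
    (sum_f_R0 (fun k => (/ 2 * ln ((y + b + INR k) ^ 2 + 0 ^ 2)
                       - / 2 * ln ((y + INR k) ^ 2 + 0 ^ 2))
       + / ((INR k + 1) * (INR k + 2)) * (b * (y - x))) n).
  - apply sum_growing; intros k.
    assert (Hk := pos_INR k).
    rewrite !half_ln_sqr by lra.
    set (X := x + INR k); replace (x + b + INR k) with (X + b) by (unfold X; ring).
    set (Y := y + INR k); replace (y + b + INR k) with (Y + b) by (unfold Y; ring).
    assert (HX : INR k + 1 <= X) by (unfold X; lra).
    assert (HY : X <= Y) by (unfold X, Y; lra).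
    assert (HYb : INR k + 2 <= Y + b) by (unfold Y; lra).
    replace (y - x) with (Y - X) by (unfold X, Y; ring).
    rewrite <- !ln_div by lra.
    enough (A : ln ((X + b) / X) - ln ((Y + b) / Y)
             <= / ((INR k + 1) * (INR k + 2)) * (b * (Y - X))) by lra.
    rewrite <- ln_div by (apply Rdiv_lt_0_compat; lra).
    eapply Rle_trans.
    { apply ln_le_sub_1; repeat apply Rdiv_lt_0_compat; lra. }
    replace ((X + b) / X / ((Y + b) / Y) - 1) with (/ (X * (Y + b)) * (b * (Y - X)))
      by (field; lra).
    apply Rmult_le_compat_r; [apply Rmult_le_pos; lra |].
    apply Rinv_le_contravar; nra.
  - rewrite sum_plus; apply Rplus_le_compat_l.
    rewrite <- scal_sum, Hn.
    assert (Hk := pos_INR n).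
    assert (0 < / (INR n + 2)) by (apply Rinv_0_lt_compat; lra).
    assert (0 <= b * (y - x)) by (apply Rmult_le_pos; lra).
    nra.
Qed.

(** This is Gamma(b + 1) = b Gamma(b): for a unit shift the sum of logarithms telescopes. *)
Lemma lnGamma_succ (b : R) : 0 < b -> lnGamma b 0 - lnGamma (b + 1) 0 = - ln b.
Proof.
  intros Hb.
  assert (H1 := is_lim_lnGamma_sub b 1 0 Hb ltac:(lra)).
  assert (Hs : forall n, sum_f_R0 (fun k => / 2 * ln ((b + 1 + INR k) ^ 2 + 0 ^ 2)
                       - / 2 * ln ((b + INR k) ^ 2 + 0 ^ 2)) n
              = ln (b + 1 + INR n) - ln b).
  { induction n as [| n IH].
    - cbn [sum_f_R0 INR]; rewrite !half_ln_sqr by lra.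
      now rewrite !Rplus_0_r.
    - rewrite tech5, IH; assert (Hk := pos_INR n).
      rewrite !half_ln_sqr by (rewrite ?S_INR; lra).
      replace (b + INR (S n)) with (b + 1 + INR n) by (rewrite S_INR; ring).
      ring. }
  enough (H2 : is_lim_seq (fun n => sum_f_R0
      (fun k => / 2 * ln ((b + 1 + INR k) ^ 2 + 0 ^ 2)
                - / 2 * ln ((b + INR k) ^ 2 + 0 ^ 2)) n - 1 * ln (INR n)) (- ln b)).
  { apply is_lim_seq_unique in H1; apply is_lim_seq_unique in H2.
    rewrite H1 in H2; now injection H2. }
  apply is_lim_seq_incr_1.
  apply is_lim_seq_ext with (fun n => ln (1 + (b + 1) * / INR (S n)) + - ln b).
  { intros n; rewrite Hs.
    assert (0 < INR (S n)) by (apply lt_0_INR; lia).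
    replace (1 + (b + 1) * / INR (S n)) with ((b + 1 + INR (S n)) / INR (S n))
      by (field; lra).
    rewrite ln_div by lra; ring. }
  replace (Finite (- ln b)) with (Finite (ln (1 + (b + 1) * 0) + - ln b))
    by (f_equal; rewrite Rmult_0_r, Rplus_0_r, ln_1; ring).
  apply is_lim_seq_plus'; [| apply is_lim_seq_const].
  apply is_lim_seq_ln; [lra |].
  apply is_lim_seq_plus'; [apply is_lim_seq_const |].
  apply (is_lim_seq_scal_l _ (b + 1) 0).
  apply (is_lim_seq_incr_1 (fun n => / INR n)).
  apply (is_lim_seq_inv INR p_infty); [apply is_lim_seq_INR | discriminate].
Qed.

Lemma lnGamma_1 : lnGamma 1 0 = 0.
Proof.
  assert (Hs : forall n, sum_f_R0 (fun k => / 2 * ln ((1 + INR k) ^ 2 + 0 ^ 2)) n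
              = ln (INR (fact (S n)))).
  { induction n as [| n IH].
    - cbn [sum_f_R0 INR]; rewrite half_ln_sqr by lra; simpl; f_equal; ring.
    - rewrite tech5, IH; assert (Hk := pos_INR (S n)).
      rewrite half_ln_sqr by lra.
      replace (1 + INR (S n)) with (INR (S (S n))) by (rewrite (S_INR (S n)); ring).
      change (fact (S (S n))) with (S (S n) * fact (S n))%nat.
      rewrite mult_INR, ln_mult;
        [ring | apply lt_0_INR; lia | apply INR_fact_lt_0]. }
  assert (H : is_lim_seq (lgmod 1 0) 0).
  { apply is_lim_seq_incr_1.
    apply is_lim_seq_ext with (fun n => - ln (1 + / INR (S n))).
    { intros n; unfold lgmod; rewrite Hs.
      change (fact (S (S n))) with (S (S n) * fact (S n))%nat.
      assert (0 < INR (S n)) by (apply lt_0_INR; lia).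
      rewrite mult_INR, ln_mult; [| apply lt_0_INR; lia | apply INR_fact_lt_0].
      replace (1 + / INR (S n)) with (INR (S (S n)) / INR (S n))
        by (rewrite (S_INR (S n)); field; lra).
      rewrite ln_div; [ring | apply lt_0_INR; lia | lra]. }
    replace (Finite 0) with (Finite (- ln (1 + 0)))
      by (f_equal; rewrite Rplus_0_r, ln_1; ring).
    apply (is_lim_seq_opp (fun n => ln (1 + / INR (S n))) (ln (1 + 0))).
    apply is_lim_seq_ln; [lra |].
    apply is_lim_seq_plus'; [apply is_lim_seq_const |].
    apply (is_lim_seq_incr_1 (fun n => / INR n)).
    apply (is_lim_seq_inv INR p_infty); [apply is_lim_seq_INR | discriminate]. }
  unfold lnGamma; now rewrite (is_lim_seq_unique _ _ H).
Qed.

Lemma argGamma_real (a : R) : 0 < a -> argGamma a 0 = 0.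
Proof.
  intros Ha; unfold argGamma.
  rewrite (is_lim_seq_unique _ 0); [reflexivity |].
  apply is_lim_seq_ext with (fun _ => 0); [| apply is_lim_seq_const].
  intros n; unfold lgarg.
  rewrite (sum_eq _ (fun _ => 0)), sum_cte; [ring |].
  intros k _; unfold Rdiv; now rewrite Rmult_0_l, atan_0.
Qed.

(** * The Beta function and the size of [T_B] *)

Lemma CBeta_polar (x b xi : R) : 0 < x -> 0 < b -> 0 <= xi ->
  CBeta (x, xi) (RtoC b) =
  polar (exp (lnGamma x xi - lnGamma (x + b) xi + lnGamma b 0))
        (argGamma x xi - argGamma (x + b) xi).
Proof.
  intros Hx Hb Hxi; unfold CBeta.
  replace (Cplus (x, xi) (RtoC b)) with (x + b, xi)
    by (unfold Cplus, RtoC; simpl; now rewrite Rplus_0_r).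
  change (RtoC b) with (b, 0).
  rewrite !CGamma_polar by lra.
  rewrite polar_mult, polar_div by apply Rgt_not_eq, exp_pos.
  rewrite argGamma_real, Rplus_0_r by exact Hb.
  f_equal; unfold Rminus; rewrite !exp_plus, exp_Ropp.
  field; apply Rgt_not_eq, exp_pos.
Qed.

(** Moving to the real axis, and then down to x = 1, never decreases the modulus of the Beta
    function, and B(1, b) = 1 / b. *)
Lemma Beta_le_inv (x b xi : R) : 1 <= x -> 0 < b ->
  exp (lnGamma x xi - lnGamma (x + b) xi + lnGamma b 0) <= / b.
Proof.
  intros Hx Hb.
  rewrite <- (exp_ln (/ b)), ln_Rinv by (try apply Rinv_0_lt_compat; exact Hb).
  assert (A1 := lnGamma_sub_le_real x b xi ltac:(lra) ltac:(lra)).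
  assert (A2 := lnGamma_sub_decr 1 x b ltac:(lra) ltac:(lra)).
  assert (A3 := lnGamma_succ b Hb).
  rewrite lnGamma_1, (Rplus_comm 1 b) in A2.
  apply exp_le_exp; lra.
Qed.

Definition T_B_mod (alpha tau xi : R) : R :=
  sin (PI * alpha) / PI *
  exp (lnGamma (tau - 2 * alpha + 1) xi
       - lnGamma (tau - 2 * alpha + 1 + 2 * alpha) xi + lnGamma (2 * alpha) 0).

Definition T_B_arg (alpha tau xi : R) : R :=
  argGamma (tau - 2 * alpha + 1) xi - argGamma (tau - 2 * alpha + 1 + 2 * alpha) xi.

Lemma sin_PI_mult_pos (a : R) : 0 < a < 1 -> 0 < sin (PI * a).
Proof. intros Ha; assert (H := PI_RGT_0); apply sin_gt_0; nra. Qed.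

Lemma T_B_mod_pos (alpha tau xi : R) : 0 < alpha < 1 -> 0 < T_B_mod alpha tau xi.
Proof.
  intros Ha; apply Rmult_lt_0_compat; [| apply exp_pos].
  apply Rdiv_lt_0_compat; [now apply sin_PI_mult_pos | apply PI_RGT_0].
Qed.

Lemma T_B_polar (alpha tau xi : R) : 0 < alpha < 1 -> 1 < tau -> 0 <= xi ->
  T_B alpha tau xi = polar (T_B_mod alpha tau xi) (T_B_arg alpha tau xi).
Proof.
  intros Ha Ht Hxi; unfold T_B.
  rewrite CBeta_polar, RtoC_polar, polar_mult, Rplus_0_l by lra.
  reflexivity.
Qed.

Lemma T_B_mod_lt_half (alpha tau xi : R) : 0 < alpha < 1 -> 2 * alpha <= tau ->
  T_B_mod alpha tau xi < / 2.
Proof.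
  intros Ha Ht; unfold T_B_mod.
  assert (HP := PI_RGT_0).
  assert (Hs := sin_PI_mult_pos alpha Ha).
  assert (Hl : sin (PI * alpha) < PI * alpha) by (apply sin_lt_x; nra).
  assert (HB := Beta_le_inv (tau - 2 * alpha + 1) (2 * alpha) xi ltac:(lra) ltac:(lra)).
  apply Rle_lt_trans with (sin (PI * alpha) / PI * / (2 * alpha)).
  - apply Rmult_le_compat_l; [left; apply Rdiv_lt_0_compat; lra | exact HB].
  - replace (sin (PI * alpha) / PI * / (2 * alpha))
      with (sin (PI * alpha) / (PI * alpha) * / 2) by (field; lra).
    assert (sin (PI * alpha) / (PI * alpha) < 1); [| lra].
    apply Rlt_div_l; nra.
Qed.

(** * The modulus of the sine quotient for xi >= 1/4 *)

Lemma Csin_PI (p q : R) : Csin (Cmult (RtoC PI) (p, q)) =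
  (sin (PI * p) * cosh (PI * q), cos (PI * p) * sinh (PI * q)).
Proof.
  unfold Csin, Cmult, RtoC; simpl.
  replace (PI * p - 0 * q) with (PI * p) by ring.
  replace (PI * q + 0 * p) with (PI * q) by ring.
  reflexivity.
Qed.

Lemma cosh_sqr (y : R) : cosh y ^ 2 = 1 + sinh y ^ 2.
Proof.
  unfold cosh, sinh.
  assert (H : exp y * exp (- y) = 1)
    by (rewrite <- exp_plus, Rplus_opp_r; apply exp_0).
  nra.
Qed.

Lemma Cmod_Csin_PI (p q : R) : Cmod (Csin (Cmult (RtoC PI) (p, q))) =
  sqrt (sin (PI * p) ^ 2 + sinh (PI * q) ^ 2).
Proof.
  rewrite Csin_PI; unfold Cmod; simpl fst; simpl snd; f_equal.
  rewrite !Rpow_mult_distr, cosh_sqr.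
  assert (H := sin2_cos2 (PI * p)); unfold Rsqr in H.
  replace (cos (PI * p) ^ 2) with (1 - sin (PI * p) ^ 2) by nra.
  ring.
Qed.

Lemma sinh_neg (y : R) : sinh (- y) = - sinh y.
Proof. unfold sinh; rewrite Ropp_involutive; field. Qed.

Lemma cosh_neg (y : R) : cosh (- y) = cosh y.
Proof. unfold cosh; rewrite Ropp_involutive; field. Qed.

Lemma sinh_pos (y : R) : 0 < y -> 0 < sinh y.
Proof.
  intros Hy; unfold sinh.
  assert (exp (- y) < exp y) by (apply exp_increasing; lra). lra.
Qed.

Lemma T_s_mod_ge_half (alpha tau xi : R) : 1 / 4 <= xi ->
  / 2 <= Cmod (T_s alpha tau xi).
Proof.
  intros Hxi; unfold T_s.
  assert (HP := PI2_3_2).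
  assert (Hy : 3 / 4 <= PI * xi) by nra.
  (* The squared modulus of the quotient is at least S / (1 + S) with S = sinh(pi xi)^2, and this
     reaches 1/4 exactly when S >= 1/3. From pi xi >= 3/4 the exponential bounds 7/4 and 4/7 give
     sinh(pi xi) >= 33/56, whose square exceeds 1/3. *)
  assert (Hs : / 3 <= sinh (PI * - xi) ^ 2).
  { rewrite Ropp_mult_distr_r_reverse, sinh_neg.
    unfold sinh; set (y := PI * xi) in *.
    assert (H1 := exp_ineq1_le y).
    assert (H2 : exp (- y) <= / (7 / 4)).
    { rewrite exp_Ropp; apply Rinv_le_contravar; lra. }
    nra. }
  assert (Hb := SIN_bound (PI * (1 - tau + 2 * alpha))).
  assert (H0 := Cmod_Csin_PI (1 - tau + 2 * alpha) (- xi)).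
  assert (Hd : 0 < sqrt (sin (PI * (1 - tau + 2 * alpha)) ^ 2 + sinh (PI * - xi) ^ 2))
    by (apply sqrt_lt_R0; nra).
  rewrite Cmod_div, !Cmod_Csin_PI.
  - apply Rle_div_r; [exact Hd |].
    replace (/ 2) with (sqrt (/ 4)).
    2: { replace (/ 4) with (Rsqr (/ 2)) by (unfold Rsqr; field).
         apply sqrt_Rsqr; lra. }
    rewrite <- sqrt_mult by nra.
    apply sqrt_le_1; nra.
  - intros E; rewrite E, Cmod_0 in H0; lra.
Qed.

Lemma T_s_mod_gt_T_B_mod (alpha tau xi : R) :
  0 < alpha < 1 -> 1 / 4 <= xi -> 1 + alpha <= tau < 2 ->
  Cmod (T_s alpha tau xi) > Cmod (T_B alpha tau xi).
Proof.
  intros Ha Hxi Ht.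
  rewrite T_B_polar, Cmod_polar, Rabs_pos_eq by
    (try (left; apply T_B_mod_pos); lra).
  assert (H1 := T_s_mod_ge_half alpha tau xi Hxi).
  assert (H2 := T_B_mod_lt_half alpha tau xi Ha ltac:(lra)).
  lra.
Qed.

(** * The real axis *)

Lemma x_cos_le_sin (x : R) : 0 <= x <= PI -> x * cos x <= sin x.
Proof.
  intros [[Hx | <-] HP]; [| rewrite sin_0; lra].
  destruct (mean_value (fun x => sin x - x * cos x) (fun x => x * sin x) 0 x Hx)
    as [c [Hc E]].
  - intros c _; auto_derive; [exact I | ring].
  - cbv beta in E; rewrite sin_0, Rmult_0_l in E.
    assert (0 < sin c) by (apply sin_gt_0; lra).
    assert (0 < c * sin c * (x - 0)) by (repeat apply Rmult_lt_0_compat; lra).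
    lra.
Qed.

(** The case b = 0 matters: on the real axis the denominator of [T_s] vanishes at tau = 2 alpha and
    tau = 1 + 2 alpha, where both quotients take the default value 0. *)
Lemma RtoC_div_total (a b : R) : Cdiv (a, 0) (b, 0) = RtoC (a / b).
Proof.
  unfold Cdiv, Cinv, Cmult, RtoC; simpl fst; simpl snd.
  destruct (Req_dec b 0) as [-> | Hb].
  - unfold Rdiv; rewrite Rinv_0; f_equal; ring.
  - f_equal; field; nra.
Qed.

Lemma T_s_real (alpha tau : R) : T_s alpha tau 0 =
  RtoC (sin (PI * (1 - tau + alpha)) / sin (PI * (1 - tau + 2 * alpha))).
Proof.
  unfold T_s; rewrite !Csin_PI, Ropp_0, Rmult_0_r, sinh_0, cosh_0, !Rmult_0_r, !Rmult_1_r.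
  apply RtoC_div_total.
Qed.

Lemma T_B_real (alpha tau : R) : 0 < alpha < 1 -> 1 < tau ->
  T_B alpha tau 0 = RtoC (T_B_mod alpha tau 0).
Proof.
  intros Ha Ht; rewrite T_B_polar, RtoC_polar by lra.
  unfold T_B_arg; rewrite !argGamma_real by lra.
  now rewrite Rminus_0_r.
Qed.

Lemma T_s_eq_T_B_real (alpha tau : R) : 0 < alpha < 1 -> 1 < tau ->
  (T_s alpha tau 0 = T_B alpha tau 0 <->
   sin (PI * (1 - tau + alpha)) / sin (PI * (1 - tau + 2 * alpha))
   = T_B_mod alpha tau 0).
Proof.
  intros Ha Ht; rewrite T_s_real, T_B_real by assumption; split.
  - apply RtoC_inj.
  - now intros ->.
Qed.

Lemma Rdiv_le_0_opp (a b : R) : 0 <= a -> b <= 0 -> a / b <= 0.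
Proof.
  intros Ha [Hb | ->]; unfold Rdiv.
  - assert (H := Rinv_lt_0_compat b Hb); nra.
  - rewrite Rinv_0; lra.
Qed.

(** [T_B] is positive, so a quotient of sines that is nonpositive, or 0 by default at a pole, gives
    no solution. The only other region to exclude is tau > 1 + 2 alpha, where the quotient exceeds
    1/2 and [T_B] does not. *)
Lemma real_solution_range (alpha tau : R) : 0 < alpha < 1 -> 1 < tau < 2 ->
  sin (PI * (1 - tau + alpha)) / sin (PI * (1 - tau + 2 * alpha))
   = T_B_mod alpha tau 0 ->
  2 * alpha < tau < 1 + alpha.
Proof.
  intros Ha Ht E.
  assert (HP := PI_RGT_0).
  assert (Hm := T_B_mod_pos alpha tau 0 Ha).
  set (p := 1 - tau + alpha) in *; set (q := 1 - tau + 2 * alpha) in *.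
  assert (Hpq : q = p + alpha) by (unfold p, q; ring).
  destruct (Rle_or_lt 1 q) as [Hq | Hq].
  - exfalso.
    assert (0 < sin (PI * p)) by (apply sin_PI_mult_pos; unfold p, q in *; lra).
    assert (sin (PI * q) <= 0) by (apply sin_le_0; unfold q in *; nra).
    assert (A := Rdiv_le_0_opp (sin (PI * p)) (sin (PI * q)) ltac:(lra) ltac:(lra)).
    lra.
  - destruct (Rle_or_lt p 0) as [Hp | Hp]; [exfalso | unfold p, q in *; lra].
    assert (Hs : 0 <= sin (PI * - p)) by (apply sin_ge_0; unfold p, q in *; nra).
    rewrite Ropp_mult_distr_r_reverse, sin_neg in Hs.
    destruct (Rle_or_lt 0 q) as [Hq0 | Hq0].
    + assert (0 <= sin (PI * q)) by (apply sin_ge_0; nra).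
      assert (A := Rdiv_le_0_opp (- sin (PI * p)) (- sin (PI * q)) Hs ltac:(lra)).
      rewrite Rdiv_opp_l, Rdiv_opp_r, Ropp_involutive in A; lra.
    + assert (Hm2 := T_B_mod_lt_half alpha tau 0 Ha ltac:(unfold q in *; lra)).
      assert (H1 : 0 < sin (PI * - q)) by (apply sin_PI_mult_pos; unfold q in *; lra).
      assert (H2 : 0 < sin (PI * (tau - 1))) by (apply sin_PI_mult_pos; lra).
      (* As cos(pi alpha) <= 1 and sin(pi (tau - 1)) > 0, this identity gives sin(- pi q) < 2 sin(-
         pi p), hence a quotient above 1/2. *)
      assert (H3 : sin (PI * - q) + sin (PI * (tau - 1))
                   = 2 * sin (PI * - p) * cos (PI * alpha)).
      { replace (PI * - q) with (PI * - p - PI * alpha) by (rewrite Hpq; ring).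
        replace (PI * (tau - 1)) with (PI * - p + PI * alpha) by (unfold p; ring).
        rewrite sin_plus, sin_minus; ring. }
      rewrite !Ropp_mult_distr_r_reverse, !sin_neg in *.
      assert (Hc := COS_bound (PI * alpha)).
      assert (sin (PI * p) / sin (PI * q) > / 2); [| lra].
      replace (sin (PI * p) / sin (PI * q)) with (- sin (PI * p) / - sin (PI * q))
        by (field; lra).
      apply Rlt_div_r; nra.
Qed.

(** This is the sign of the derivative in [real_ratio_exp_decr]. With h = pi alpha / 2 the product
    of sines is at most cos(h)^2, so it suffices that alpha cos h < pi sin h; this follows from h
    cos h <= sin h and pi h > alpha. *)
Lemma two_alpha_sin_sin_lt (alpha u : R) : 0 < alpha < 1 ->
  2 * alpha * (sin u * sin (u + PI * alpha)) < PI * sin (PI * alpha).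
Proof.
  intros Ha.
  assert (HP := PI2_3_2).
  set (h := PI * alpha / 2).
  replace (PI * alpha) with (2 * h) by (unfold h; field).
  assert (Hh : 0 < h < PI / 2) by (unfold h; nra).
  assert (Hc : 0 < cos h) by (apply cos_gt_0; lra).
  assert (Hs := x_cos_le_sin h ltac:(lra)).
  assert (H1 : sin u * sin (u + 2 * h) <= cos h ^ 2).
  { assert (A := COS_bound (u + (u + 2 * h))).
    rewrite cos_plus in A.
    assert (B : cos (u + 2 * h - u) = 2 * cos h ^ 2 - 1).
    { replace (u + 2 * h - u) with (2 * h) by ring.
      rewrite cos_2a_cos; ring. }
    rewrite cos_minus in B; nra. }
  rewrite sin_2a.
  apply Rle_lt_trans with (2 * alpha * cos h ^ 2); [nra |].
  assert (alpha * cos h < PI * sin h); [| nra].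
  assert (PI * (h * cos h) <= PI * sin h) by nra.
  assert (9 <= PI * PI) by nra.
  assert (alpha < PI * h) by (unfold h; nra).
  nra.
Qed.

Lemma real_ratio_exp_decr (alpha tau1 tau2 : R) : 0 < alpha < 1 ->
  2 * alpha < tau1 -> tau1 < tau2 -> tau2 < 1 + alpha ->
  sin (PI * (1 - tau2 + alpha)) / sin (PI * (1 - tau2 + 2 * alpha))
    * exp (2 * alpha * tau2) <
  sin (PI * (1 - tau1 + alpha)) / sin (PI * (1 - tau1 + 2 * alpha))
    * exp (2 * alpha * tau1).
Proof.
  intros Ha H1 H2 H3.
  assert (Hq : forall c, tau1 <= c <= tau2 -> 0 < sin (PI * (1 - c + 2 * alpha)))
    by (intros c Hc; apply sin_PI_mult_pos; lra).
  destruct (mean_value (fun t =>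
     sin (PI * (1 - t + alpha)) / sin (PI * (1 - t + 2 * alpha)) * exp (2 * alpha * t))
    (fun t => exp (2 * alpha * t) / sin (PI * (1 - t + 2 * alpha)) ^ 2 *
      (2 * alpha * (sin (PI * (1 - t + alpha)) * sin (PI * (1 - t + 2 * alpha)))
       - PI * sin (PI * alpha))) tau1 tau2 H2) as [c [Hc E]].
  - intros c Hc; specialize (Hq c Hc).
    auto_derive; [repeat split; apply Rgt_not_eq, Hq |].
    replace (PI * alpha) with (PI * (1 - c + 2 * alpha) - PI * (1 - c + alpha)) by ring.
    rewrite sin_minus.
    replace (1 + - c + 2 * alpha) with (1 - c + 2 * alpha) by ring.
    replace (1 + - c + alpha) with (1 - c + alpha) by ring.
    field; lra.
  - cbv beta in E.
    assert (A := two_alpha_sin_sin_lt alpha (PI * (1 - c + alpha)) Ha).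
    replace (PI * (1 - c + alpha) + PI * alpha) with (PI * (1 - c + 2 * alpha)) in A by ring.
    assert (B : 0 < exp (2 * alpha * c) / sin (PI * (1 - c + 2 * alpha)) ^ 2).
    { apply Rdiv_lt_0_compat; [apply exp_pos | apply pow_lt, Hq; lra]. }
    set (X := exp (2 * alpha * c) / _) in *.
    set (Y := 2 * alpha * _ - PI * sin (PI * alpha)) in *.
    assert (Y < 0) by (unfold Y; lra).
    clearbody X Y.
    assert (0 < X * (- Y) * (tau2 - tau1))
      by (repeat apply Rmult_lt_0_compat; lra).
    lra.
Qed.

Lemma T_B_mod_lipschitz (alpha tau1 tau2 : R) : 0 < alpha < 1 ->
  1 <= tau1 -> 2 * alpha <= tau1 -> tau1 <= tau2 ->
  T_B_mod alpha tau1 0 * exp (2 * alpha * tau1)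
    <= T_B_mod alpha tau2 0 * exp (2 * alpha * tau2).
Proof.
  intros Ha H1 H2 H3; unfold T_B_mod.
  assert (A := lnGamma_sub_lipschitz (tau1 - 2 * alpha + 1) (tau2 - 2 * alpha + 1)
                 (2 * alpha) ltac:(lra) ltac:(lra) ltac:(lra)).
  rewrite !Rmult_assoc; apply Rmult_le_compat_l.
  { left; apply Rdiv_lt_0_compat; [now apply sin_PI_mult_pos | apply PI_RGT_0]. }
  rewrite <- !exp_plus.
  apply exp_le_exp; lra.
Qed.

Lemma real_solution_unique (alpha tau1 tau2 : R) : 0 < alpha < 1 ->
  1 < tau1 < 2 -> 1 < tau2 < 2 ->
  T_s alpha tau1 0 = T_B alpha tau1 0 -> T_s alpha tau2 0 = T_B alpha tau2 0 ->
  tau1 = tau2.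
Proof.
  intros Ha.
  assert (W : forall t1 t2, 1 < t1 < 2 -> 1 < t2 < 2 -> t1 < t2 ->
    T_s alpha t1 0 = T_B alpha t1 0 -> T_s alpha t2 0 = T_B alpha t2 0 -> False).
  { intros t1 t2 H1 H2 H12 E1 E2.
    apply T_s_eq_T_B_real in E1; [| lra | lra].
    apply T_s_eq_T_B_real in E2; [| lra | lra].
    assert (R1 := real_solution_range _ _ Ha H1 E1).
    assert (R2 := real_solution_range _ _ Ha H2 E2).
    assert (A := real_ratio_exp_decr alpha t1 t2 Ha ltac:(lra) H12 ltac:(lra)).
    assert (B := T_B_mod_lipschitz alpha t1 t2 Ha ltac:(lra) ltac:(lra) ltac:(lra)).
    rewrite E1, E2 in A; lra. }
  intros H1 H2 E1 E2.
  destruct (Rtotal_order tau1 tau2) as [H | [H | H]]; [| exact H |]; exfalso; eauto.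
Qed.

Lemma lipschitz_continuity (f : R -> R) (K : R) : 0 <= K ->
  (forall x y, x <= y -> Rabs (f x - f y) <= K * (y - x)) -> continuity f.
Proof.
  intros HK H x eps Heps.
  exists (eps / (K + 1)); split; [apply Rdiv_lt_0_compat; lra |].
  intros y [_ Hy]; simpl in *; unfold Rdist in *.
  apply Rle_lt_trans with (K * Rabs (y - x)).
  - destruct (Rle_or_lt x y) as [L | L].
    + rewrite Rabs_minus_sym, (Rabs_pos_eq (y - x)) by lra; auto.
    + rewrite (Rabs_minus_sym y x), (Rabs_pos_eq (x - y)) by lra.
      apply H; lra.
  - apply Rlt_div_r in Hy; [| lra].
    assert (A := Rabs_pos (y - x)); nra.
Qed.

Lemma real_solution_exists (alpha : R) : 0 < alpha < 1 ->
  exists tau, 1 < tau < 1 + alpha /\ T_s alpha tau 0 = T_B alpha tau 0.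
Proof.
  intros Ha.
  set (L := Rmax 1 (2 * alpha)).
  assert (HL1 : 1 <= L) by apply Rmax_l.
  assert (HL2 : 2 * alpha <= L) by apply Rmax_r.
  assert (HL3 : L < 1 + alpha) by (apply Rmax_lub_lt; lra).
  (* Clamping at [L] makes the Lipschitz bound global, so that the intermediate
     value theorem applies up to the left endpoint. *)
  set (D := fun t => lnGamma (Rmax L t - 2 * alpha + 1) 0
              - lnGamma (Rmax L t - 2 * alpha + 1 + 2 * alpha) 0).
  assert (HD : continuity D).
  { apply lipschitz_continuity with (2 * alpha); [lra |].
    intros x y Hxy; unfold D.
    assert (M1 : L <= Rmax L x) by apply Rmax_l.
    assert (M2 : Rmax L x <= Rmax L y <= Rmax L x + (y - x)).
    { unfold Rmax; destruct (Rle_dec L x); destruct (Rle_dec L y); lra. }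
    assert (A := lnGamma_sub_decr (Rmax L x - 2 * alpha + 1) (Rmax L y - 2 * alpha + 1)
                 (2 * alpha) ltac:(lra) ltac:(lra)).
    assert (B := lnGamma_sub_lipschitz (Rmax L x - 2 * alpha + 1)
       (Rmax L y - 2 * alpha + 1) (2 * alpha) ltac:(lra) ltac:(lra) ltac:(lra)).
    rewrite Rabs_pos_eq by lra.
    assert (2 * alpha * (Rmax L y - 2 * alpha + 1 - (Rmax L x - 2 * alpha + 1))
            <= 2 * alpha * (y - x)) by (apply Rmult_le_compat_l; lra).
    lra. }
  (* Clearing the denominator removes the pole at t = 2 alpha, which is the left endpoint when 2
     alpha > 1. *)
  set (F := fun t => T_B_mod alpha (Rmax L t) 0 * sin (PI * (1 - t + 2 * alpha))
                     - sin (PI * (1 - t + alpha))).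
  assert (HF : continuity F).
  { unfold F, T_B_mod; fold (D 0).
    assert (Hexp : continuity (fun t => exp (D t + lnGamma (2 * alpha) 0))).
    { intros t; apply (continuity_pt_comp (fun t => D t + lnGamma (2 * alpha) 0) exp).
      - apply continuity_pt_plus; [apply HD | apply continuity_pt_const; easy].
      - apply derivable_continuous_pt, derivable_pt_exp. }
    assert (Hsin : forall c, continuity (fun t => sin (PI * (1 - t + c)))).
    { intros c t; apply continuity_pt_filterlim.
      apply (ex_derive_continuous (fun t => sin (PI * (1 - t + c)))).
      auto_derive; exact I. }
    intros t; apply continuity_pt_minus; [| apply Hsin].
    apply continuity_pt_mult; [| apply Hsin].
    apply (continuity_pt_scal (fun t => exp (D t + lnGamma (2 * alpha) 0))), Hexp. }
  assert (HP := PI_RGT_0).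
  assert (F0 : F L < 0).
  { unfold F; rewrite Rmax_left by lra.
    assert (M1 := T_B_mod_pos alpha L 0 Ha).
    assert (M2 := T_B_mod_lt_half alpha L 0 Ha HL2).
    (* At L = 1 the value is sin(pi alpha) (2 T_B cos(pi alpha) - 1), negative because T_B < 1/2. At
       L = 2 alpha the first product vanishes. *)
    destruct (Rle_or_lt (2 * alpha) 1) as [H | H].
    - replace L with 1 in * by (unfold L; rewrite Rmax_left; lra).
      replace (PI * (1 - 1 + 2 * alpha)) with (2 * (PI * alpha)) by ring.
      replace (PI * (1 - 1 + alpha)) with (PI * alpha) by ring.
      rewrite sin_2a.
      assert (S := sin_PI_mult_pos alpha Ha).
      assert (C := COS_bound (PI * alpha)).
      assert (T_B_mod alpha 1 0 * cos (PI * alpha) < / 2) by nra.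
      nra.
    - replace L with (2 * alpha) in * by (unfold L; rewrite Rmax_right; lra).
      replace (PI * (1 - 2 * alpha + 2 * alpha)) with PI by ring.
      rewrite sin_PI, Rmult_0_r.
      assert (S := sin_PI_mult_pos (1 - 2 * alpha + alpha) ltac:(lra)); lra. }
  assert (F1 : 0 < F (1 + alpha)).
  { unfold F; rewrite Rmax_right by lra.
    replace (PI * (1 - (1 + alpha) + 2 * alpha)) with (PI * alpha) by ring.
    replace (PI * (1 - (1 + alpha) + alpha)) with 0 by ring.
    rewrite sin_0, Rminus_0_r.
    apply Rmult_lt_0_compat; [now apply T_B_mod_pos | now apply sin_PI_mult_pos]. }
  destruct (IVT F L (1 + alpha) HF HL3 F0 F1) as [z [Hz Ez]].
  assert (z <> L) by (intros ->; lra).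
  assert (z <> 1 + alpha) by (intros ->; lra).
  exists z; split; [lra |].
  apply T_s_eq_T_B_real; [exact Ha | lra |].
  unfold F in Ez; rewrite Rmax_right in Ez by lra.
  assert (S := sin_PI_mult_pos (1 - z + 2 * alpha) ltac:(lra)).
  apply (Rmult_eq_reg_r (sin (PI * (1 - z + 2 * alpha)))); [| lra].
  unfold Rdiv; rewrite Rmult_assoc, Rinv_l by lra; lra.
Qed.

(** * Euler's product for the complex sine *)

(* Real and imaginary parts of cos(2wt) and sin(2wt) for w = p + iq.  With
   I_n(w) the integral of cos(2wt) cos(t)^n over [0, pi/2], two integrations by parts
   give (n^2 - 4 w^2) I_n(w) = n (n - 1) I_(n-2)(w), while 2 w I_0(w) = sin(pi w) and
   I_n(w) / I_n(0) -> 1; this yields the product. *)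
Definition cos2_re (p q t : R) : R := cos (2 * p * t) * cosh (2 * q * t).
Definition cos2_im (p q t : R) : R := - (sin (2 * p * t) * sinh (2 * q * t)).
Definition sin2_re (p q t : R) : R := sin (2 * p * t) * cosh (2 * q * t).
Definition sin2_im (p q t : R) : R := cos (2 * p * t) * sinh (2 * q * t).

Lemma is_derive_cos2_re (p q t : R) :
  is_derive (cos2_re p q) t (- (2 * (p * sin2_re p q t - q * sin2_im p q t))).
Proof.
  unfold cos2_re, sin2_re, sin2_im, cosh, sinh; auto_derive; [exact I | field].
Qed.

Lemma is_derive_cos2_im (p q t : R) :
  is_derive (cos2_im p q) t (- (2 * (p * sin2_im p q t + q * sin2_re p q t))).
Proof.
  unfold cos2_im, sin2_re, sin2_im, cosh, sinh; auto_derive; [exact I | field].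
Qed.

Lemma is_derive_sin2_re (p q t : R) :
  is_derive (sin2_re p q) t (2 * (p * cos2_re p q t - q * cos2_im p q t)).
Proof.
  unfold cos2_re, cos2_im, sin2_re, cosh, sinh; auto_derive; [exact I | field].
Qed.

Lemma is_derive_sin2_im (p q t : R) :
  is_derive (sin2_im p q) t (2 * (p * cos2_im p q t + q * cos2_re p q t)).
Proof.
  unfold cos2_re, cos2_im, sin2_im, cosh, sinh; auto_derive; [exact I | field].
Qed.

Lemma continuous_cos2_re (p q t : R) : continuous (cos2_re p q) t.
Proof. apply (ex_derive_continuous (cos2_re p q)); eexists; apply is_derive_cos2_re. Qed.

Lemma continuous_cos2_im (p q t : R) : continuous (cos2_im p q) t.
Proof. apply (ex_derive_continuous (cos2_im p q)); eexists; apply is_derive_cos2_im. Qed.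

Lemma continuous_cos_pow (n : nat) (t : R) : continuous (fun t => cos t ^ n) t.
Proof. apply (ex_derive_continuous (fun t => cos t ^ n)); auto_derive; exact I. Qed.

Lemma continuous_mult_cos_pow (f : R -> R) (n : nat) (t : R) :
  continuous f t -> continuous (fun t => f t * cos t ^ n) t.
Proof.
  intros Hf; apply (continuous_mult f (fun t => cos t ^ n) t Hf), continuous_cos_pow.
Qed.

(* The weight [f] stands for the real or the imaginary part of cos(2wt). *)
Definition wallis (f : R -> R) (n : nat) : R :=
  RInt (fun t => f t * cos t ^ n) 0 (PI / 2).

Lemma is_RInt_wallis (f : R -> R) (n : nat) : (forall t, continuous f t) ->
  is_RInt (fun t => f t * cos t ^ n) 0 (PI / 2) (wallis f n).
Proof.
  intros Hf; apply (RInt_correct (fun t => f t * cos t ^ n)), ex_RInt_continuous.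
  intros t _; apply continuous_mult_cos_pow, Hf.
Qed.

Lemma wallis_of_primitive (f g : R -> R) (a b c : R) (n : nat) (F : R -> R) :
  (forall t, continuous f t) -> (forall t, continuous g t) ->
  (forall t, is_derive F t
     (a * (f t * cos t ^ S (S n)) + b * (g t * cos t ^ S (S n)) + c * (f t * cos t ^ n))) ->
  F 0 = 0 -> F (PI / 2) = 0 ->
  a * wallis f (S (S n)) + b * wallis g (S (S n)) + c * wallis f n = 0.
Proof.
  intros Hf Hg HF F0 F1.
  pose (G := fun t => a * (f t * cos t ^ S (S n)) + b * (g t * cos t ^ S (S n))
                      + c * (f t * cos t ^ n)).
  assert (H1 : RInt G 0 (PI / 2) = F (PI / 2) - F 0).
  { apply (is_RInt_unique (V := R_CompleteNormedModule)).
    apply (is_RInt_derive (V := R_CompleteNormedModule) F).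
    - intros t _; apply HF.
    - intros t _; unfold G.
      assert (Hc : forall k h m, (forall t, continuous h t) ->
                   continuous (fun t => k * (h t * cos t ^ m)) t).
      { intros k h m Hh; apply (continuous_scal_r (V := R_NormedModule)).
        now apply continuous_mult_cos_pow. }
      exact (continuous_plus (V := R_NormedModule) _ _ t
               (continuous_plus (V := R_NormedModule) _ _ t
                  (Hc a f (S (S n)) Hf) (Hc b g (S (S n)) Hg)) (Hc c f n Hf)). }
  assert (H2 : RInt G 0 (PI / 2)
               = a * wallis f (S (S n)) + b * wallis g (S (S n)) + c * wallis f n).
  { apply (is_RInt_unique (V := R_CompleteNormedModule)).
    apply (is_RInt_plus (V := R_NormedModule));
      [apply (is_RInt_plus (V := R_NormedModule)) |];
      apply (is_RInt_scal (V := R_NormedModule)); now apply is_RInt_wallis. }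
  rewrite <- H2, H1, F0, F1; ring.
Qed.

(** The hypotheses encode f'' = -4 (u f + v g), which is one component of cos(2wt)'' = -4 w^2
    cos(2wt): u is Re w^2, and v is - Im w^2 or Im w^2 according to the component. One primitive
    performs both integrations by parts; it vanishes at 0 through [S] and sin, and at pi/2 through
    cos. *)
Lemma wallis_rec (f g S : R -> R) (u v : R) (n : nat) :
  (forall t, is_derive f t (- (2 * S t))) ->
  (forall t, is_derive S t (2 * (u * f t + v * g t))) ->
  (forall t, continuous g t) -> S 0 = 0 ->
  (4 * u - (INR n + 2) ^ 2) * wallis f (Datatypes.S (Datatypes.S n))
  + 4 * v * wallis g (Datatypes.S (Datatypes.S n))
  + (INR n + 2) * (INR n + 1) * wallis f n = 0.
Proof.
  intros Hf HS Hg HS0.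
  apply wallis_of_primitive with (F := fun t =>
    2 * S t * cos t ^ Datatypes.S (Datatypes.S n)
    - (INR n + 2) * cos t ^ Datatypes.S n * sin t * f t).
  - intros t; apply (ex_derive_continuous f); eexists; apply Hf.
  - exact Hg.
  - intros t; auto_derive.
    + repeat split; eexists; [apply HS | apply Hf].
    + change (fun x => S x) with S; change (fun x => f x) with f.
      rewrite (is_derive_unique _ _ _ (HS t)), (is_derive_unique _ _ _ (Hf t)).
      change (match n with 0%nat => 1 | Datatypes.S _ => INR n + 1 end)
        with (INR (Datatypes.S n)).
      rewrite S_INR.
      assert (E : sin t * sin t + cos t * cos t - 1 = 0)
        by (generalize (sin2_cos2 t); unfold Rsqr; lra).
      apply Rminus_diag_uniq.
      transitivity ((INR n + 2) * (INR n + 1) * cos t ^ n * f t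
                    * (sin t * sin t + cos t * cos t - 1)); [simpl; ring |].
      rewrite E; ring.
  - rewrite HS0, sin_0; ring.
  - rewrite cos_PI2; simpl; ring.
Qed.

Lemma wallis_re_rec (p q : R) (n : nat) :
  (4 * (p ^ 2 - q ^ 2) - (INR n + 2) ^ 2) * wallis (cos2_re p q) (S (S n))
  + 4 * - (2 * p * q) * wallis (cos2_im p q) (S (S n))
  + (INR n + 2) * (INR n + 1) * wallis (cos2_re p q) n = 0.
Proof.
  apply wallis_rec with (S := fun t => p * sin2_re p q t - q * sin2_im p q t).
  - apply is_derive_cos2_re.
  - intros t; auto_derive.
    + repeat split; eexists; [apply is_derive_sin2_re | apply is_derive_sin2_im].
    + change (fun x => sin2_re p q x) with (sin2_re p q).
      change (fun x => sin2_im p q x) with (sin2_im p q).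
      rewrite (is_derive_unique _ _ _ (is_derive_sin2_re p q t)),
        (is_derive_unique _ _ _ (is_derive_sin2_im p q t)); ring.
  - apply continuous_cos2_im.
  - unfold sin2_re, sin2_im; rewrite !Rmult_0_r, sin_0, sinh_0; ring.
Qed.

Lemma wallis_im_rec (p q : R) (n : nat) :
  (4 * (p ^ 2 - q ^ 2) - (INR n + 2) ^ 2) * wallis (cos2_im p q) (S (S n))
  + 4 * (2 * p * q) * wallis (cos2_re p q) (S (S n))
  + (INR n + 2) * (INR n + 1) * wallis (cos2_im p q) n = 0.
Proof.
  apply wallis_rec with (S := fun t => p * sin2_im p q t + q * sin2_re p q t).
  - apply is_derive_cos2_im.
  - intros t; auto_derive.
    + repeat split; eexists; [apply is_derive_sin2_im | apply is_derive_sin2_re].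
    + change (fun x => sin2_re p q x) with (sin2_re p q).
      change (fun x => sin2_im p q x) with (sin2_im p q).
      rewrite (is_derive_unique _ _ _ (is_derive_sin2_re p q t)),
        (is_derive_unique _ _ _ (is_derive_sin2_im p q t)); ring.
  - apply continuous_cos2_re.
  - unfold sin2_re, sin2_im; rewrite !Rmult_0_r, sin_0, sinh_0; ring.
Qed.

Definition wallis1 : nat -> R := wallis (fun _ => 1).

Lemma wallis1_rec (n : nat) : (INR n + 2) * wallis1 (S (S n)) = (INR n + 1) * wallis1 n.
Proof.
  assert (H := wallis_rec (fun _ => 1) (fun _ => 1) (fun _ => 0) 0 0 n).
  assert (Hn := pos_INR n); fold wallis1 in H.
  apply (Rmult_eq_reg_l (INR n + 2)); [| lra].
  enough (E : (4 * 0 - (INR n + 2) ^ 2) * wallis1 (S (S n)) + 4 * 0 * wallis1 (S (S n))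
      + (INR n + 2) * (INR n + 1) * wallis1 n = 0) by nra.
  apply H.
  - intros t; auto_derive; [exact I | ring].
  - intros t; auto_derive; [exact I | ring].
  - intros t; apply continuous_const.
  - reflexivity.
Qed.

Lemma wallis1_0 : wallis1 0 = PI / 2.
Proof.
  unfold wallis1, wallis.
  rewrite (RInt_ext _ (fun _ => 1)) by (intros; simpl; ring).
  rewrite RInt_const; unfold scal; simpl; unfold mult; simpl; ring.
Qed.

Lemma wallis1_even_pos (n : nat) : 0 < wallis1 (2 * n).
Proof.
  induction n as [| n IH].
  - simpl; rewrite wallis1_0; assert (H := PI_RGT_0); lra.
  - replace (2 * S n)%nat with (S (S (2 * n))) by lia.
    assert (H := wallis1_rec (2 * n)).
    assert (Hn := pos_INR (2 * n)).
    nra.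
Qed.

Lemma wallis_linear (f g : R -> R) (a b : R) (n : nat) :
  (forall t, continuous f t) -> (forall t, continuous g t) ->
  wallis (fun t => a * f t + b * g t) n = a * wallis f n + b * wallis g n.
Proof.
  intros Hf Hg; apply (is_RInt_unique (V := R_CompleteNormedModule)).
  apply (is_RInt_ext (V := R_NormedModule))
    with (fun t => a * (f t * cos t ^ n) + b * (g t * cos t ^ n)).
  - intros t _; match goal with |- ?x = ?y => change (@eq R x y) end; ring.
  - apply (is_RInt_plus (V := R_NormedModule));
      apply (is_RInt_scal (V := R_NormedModule)); now apply is_RInt_wallis.
Qed.

Lemma continuous_sin_sqr (t : R) : continuous (fun t => sin t ^ 2) t.
Proof. apply (ex_derive_continuous (fun t => sin t ^ 2)); auto_derive; exact I. Qed.

Lemma wallis_sin_sqr (n : nat) :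
  wallis (fun t => sin t ^ 2) n = wallis1 n - wallis1 (S (S n)).
Proof.
  apply (is_RInt_unique (V := R_CompleteNormedModule)).
  apply (is_RInt_ext (V := R_NormedModule))
    with (fun t => 1 * cos t ^ n - 1 * cos t ^ S (S n)).
  - intros t _; simpl; match goal with |- ?x = ?y => change (@eq R x y) end.
    assert (E := sin2_cos2 t); unfold Rsqr in E.
    replace (sin t * (sin t * 1)) with (1 - cos t * cos t) by lra; ring.
  - apply (is_RInt_minus (V := R_NormedModule));
      apply (is_RInt_wallis (fun _ => 1)); intros; apply continuous_const.
Qed.

(** The weight cos^n concentrates at 0: the recurrence gives sin^2 the integral wallis1 n / (n + 2),
    so a function of order sin^2 contributes a fraction O(1 / n) of the total mass. *)
Lemma wallis_bound (f : R -> R) (C : R) (n : nat) : (forall t, continuous f t) ->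
  (forall t, 0 <= t <= PI / 2 -> Rabs (f t) <= C * sin t ^ 2) ->
  Rabs (wallis f n) <= C * (wallis1 n / (INR n + 2)).
Proof.
  intros Hf H.
  assert (E : wallis1 n / (INR n + 2) = wallis (fun t => sin t ^ 2) n).
  { rewrite wallis_sin_sqr; assert (R := wallis1_rec n); assert (Hn := pos_INR n).
    apply (Rmult_eq_reg_l (INR n + 2)); [| lra].
    rewrite Rmult_minus_distr_l, R; field; lra. }
  rewrite E.
  assert (HP := PI_RGT_0).
  assert (G : forall e, e = 1 \/ e = -1 -> e * wallis f n <= C * wallis (fun t => sin t ^ 2) n).
  { intros e He.
    (* Adding 0 * wallis f n to each side gives it the two-term shape of [wallis_linear], so that
       both become single integrals. *)
    rewrite <- (Rplus_0_r (e * wallis f n)), <- (Rmult_0_l (wallis f n)) at 1.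
    rewrite <- (Rplus_0_r (C * _)), <- (Rmult_0_l (wallis f n)).
    rewrite <- !wallis_linear by auto using continuous_sin_sqr.
    apply RInt_le; [lra | | |].
    1, 2: eexists; apply is_RInt_wallis; intros t;
      apply (continuous_plus (V := R_NormedModule));
      apply (continuous_scal_r (V := R_NormedModule)); auto using continuous_sin_sqr.
    intros t Ht.
    apply Rmult_le_compat_r; [apply pow_le, cos_ge_0; lra |].
    specialize (H t ltac:(lra)); apply Rabs_le_between in H.
    destruct He as [-> | ->]; lra. }
  apply Rabs_le; split.
  - specialize (G (-1) ltac:(auto)); lra.
  - specialize (G 1 ltac:(auto)); lra.
Qed.

Lemma half_le_sin (t : R) : 0 <= t <= PI / 2 -> t <= 2 * sin t.
Proof.
  intros Ht; assert (HP := PI_RGT_0).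
  replace t with (2 * (t / 2)) at 2 by field.
  rewrite sin_2a.
  assert (H1 := x_cos_le_sin (t / 2) ltac:(lra)).
  assert (H2 : 0 <= cos (t / 2)) by (apply cos_ge_0; lra).
  assert (H3 := cos_2a_cos (t / 2)).
  replace (2 * (t / 2)) with t in H3 by field.
  assert (H4 : 1 / 2 <= cos (t / 2) * cos (t / 2))
    by (assert (0 <= cos t) by (apply cos_ge_0; lra); lra).
  assert (t / 2 * (cos (t / 2) * cos (t / 2)) <= sin (t / 2) * cos (t / 2)) by nra.
  nra.
Qed.

Lemma sinh_abs_le (y : R) : Rabs (sinh y) <= Rabs y * exp (Rabs y).
Proof.
  assert (H : forall y, 0 <= y -> sinh y <= y * exp y).
  { clear y; intros y Hy; unfold sinh.
    assert (A := exp_ineq1_le (- (2 * y))).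
    replace (exp (- y)) with (exp y * exp (- (2 * y)))
      by (rewrite <- exp_plus; f_equal; ring).
    assert (B := exp_pos y); nra. }
  assert (P : forall y, 0 <= y -> 0 <= sinh y).
  { intros z [Hz | <-]; [left; now apply sinh_pos | rewrite sinh_0; lra]. }
  destruct (Rle_or_lt 0 y) as [Hy | Hy].
  - rewrite !Rabs_pos_eq; auto.
  - assert (P' := P (- y) ltac:(lra)); assert (H' := H (- y) ltac:(lra)).
    rewrite sinh_neg in P', H'.
    rewrite (Rabs_left1 y), (Rabs_left1 (sinh y)) by lra; exact H'.
Qed.

Lemma cosh_le_exp_abs (y : R) : 1 <= cosh y <= exp (Rabs y).
Proof.
  unfold cosh; split.
  - assert (A := exp_ineq1_le y); assert (B := exp_ineq1_le (- y)); lra.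
  - assert (A := exp_le_exp y (Rabs y) (Rle_abs y)).
    assert (B := exp_le_exp (- y) (Rabs y)).
    rewrite <- Rabs_Ropp in B at 1; specialize (B (Rle_abs _)); lra.
Qed.

Lemma sin_abs_le (x : R) : Rabs (sin x) <= Rabs x.
Proof.
  destruct (MVT_abs sin cos 0 x) as [c [E _]].
  - intros; apply derivable_pt_lim_sin.
  - rewrite sin_0, !Rminus_0_r in E; rewrite E.
    assert (Rabs (cos c) <= 1) by (apply Rabs_le, COS_bound).
    assert (A := Rabs_pos x); nra.
Qed.

(** Both components of cos(2wt) - 1 are O(t^2). [K] bounds exp |2qt| on the interval, and the
    leading 4 in [C] comes from t <= 2 sin t, which yields the form required by [wallis_bound]. *)
Lemma cos2_sub_1_bound (p q t : R) : 0 <= t <= PI / 2 ->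
  let K := exp (PI * Rabs q) in
  let C := 4 * (4 * Rabs p * Rabs q * K + 2 * p ^ 2 * K + 2 * q ^ 2 * K ^ 2) in
  Rabs (cos2_re p q t - 1) <= C * sin t ^ 2 /\ Rabs (cos2_im p q t) <= C * sin t ^ 2.
Proof.
  intros Ht K C; assert (HP := PI_RGT_0).
  assert (HK : 1 <= K).
  { unfold K; assert (A := exp_ineq1_le (PI * Rabs q)); assert (B := Rabs_pos q); nra. }
  assert (Hp := Rabs_pos p); assert (Hq := Rabs_pos q).
  assert (Hp2 : Rabs p ^ 2 = p ^ 2) by apply pow2_abs.
  assert (Hq2 : Rabs q ^ 2 = q ^ 2) by apply pow2_abs.
  assert (HY : forall c, 0 <= c <= 2 -> Rabs (c * q * t) = c * Rabs q * t
                /\ exp (Rabs (c * q * t)) <= K).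
  { intros c Hc; rewrite !Rabs_mult, (Rabs_pos_eq c), (Rabs_pos_eq t) by lra.
    split; [reflexivity |]; apply exp_le_exp.
    assert (c * t <= PI) by nra; nra. }
  assert (HX : forall c, 0 <= c -> Rabs (c * p * t) = c * Rabs p * t)
    by (intros c Hc; now rewrite !Rabs_mult, (Rabs_pos_eq c), (Rabs_pos_eq t) by lra).
  assert (Hsh : forall c, 0 <= c <= 2 -> Rabs (sinh (c * q * t)) <= c * Rabs q * t * K).
  { intros c Hc; destruct (HY c Hc) as [E1 E2].
    eapply Rle_trans; [apply sinh_abs_le |]; rewrite E1 in *.
    apply Rmult_le_compat_l; [| exact E2].
    repeat apply Rmult_le_pos; lra. }
  assert (Hsn : forall c, 0 <= c -> Rabs (sin (c * p * t)) <= c * Rabs p * t)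
    by (intros c Hc; eapply Rle_trans; [apply sin_abs_le | rewrite HX; lra]).
  assert (Ht2 : t ^ 2 <= 4 * sin t ^ 2)
    by (assert (A := half_le_sin t Ht); nra).
  set (C0 := 4 * Rabs p * Rabs q * K + 2 * p ^ 2 * K + 2 * q ^ 2 * K ^ 2) in C.
  assert (T1 : 0 <= Rabs p * Rabs q * K) by (repeat apply Rmult_le_pos; lra).
  assert (T2 : 0 <= p ^ 2 * K) by (apply Rmult_le_pos; nra).
  assert (T3 : 0 <= q ^ 2 * K ^ 2) by (apply Rmult_le_pos; nra).
  enough (G : Rabs (cos2_re p q t - 1) <= C0 * t ^ 2 /\ Rabs (cos2_im p q t) <= C0 * t ^ 2).
  { assert (C0 * t ^ 2 <= C * sin t ^ 2); [| lra].
    unfold C; assert (0 <= C0) by (unfold C0; lra); nra. }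
  split.
  - assert (Ec : cos (2 * p * t) = 1 - 2 * (sin (1 * p * t) * sin (1 * p * t))).
    { replace (2 * p * t) with (2 * (1 * p * t)) by ring; rewrite cos_2a_sin; ring. }
    assert (Eh : cosh (2 * q * t) = 1 + 2 * sinh (1 * q * t) ^ 2).
    { unfold cosh, sinh.
      assert (E : exp (1 * q * t) * exp (- (1 * q * t)) = 1)
        by (rewrite <- exp_plus, Rplus_opp_r; apply exp_0).
      replace (2 * q * t) with (1 * q * t + 1 * q * t) by ring.
      rewrite Ropp_plus_distr, !exp_plus; nra. }
    destruct (HY 2 ltac:(lra)) as [_ E2].
    assert (Hc := cosh_le_exp_abs (2 * q * t)).
    assert (S1 := Hsn 1 ltac:(lra)); assert (S2 := Hsh 1 ltac:(lra)).
    assert (Q1 : sin (1 * p * t) ^ 2 <= p ^ 2 * t ^ 2).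
    { rewrite <- (pow2_abs (sin _)), <- Hp2, <- Rpow_mult_distr.
      apply pow_incr; split; [apply Rabs_pos | lra]. }
    assert (Q2 : sinh (1 * q * t) ^ 2 <= q ^ 2 * K ^ 2 * t ^ 2).
    { rewrite <- (pow2_abs (sinh _)), <- Hq2, <- !Rpow_mult_distr.
      apply pow_incr; split; [apply Rabs_pos | lra]. }
    unfold cos2_re.
    (* The double-angle formulas cancel the constant term and leave only quadratic ones. *)
    replace (cos (2 * p * t) * cosh (2 * q * t) - 1) with
      (2 * sinh (1 * q * t) ^ 2 - 2 * sin (1 * p * t) ^ 2 * cosh (2 * q * t))
      by (rewrite Ec, Eh; ring).
    assert (Q3 : sin (1 * p * t) ^ 2 * cosh (2 * q * t) <= p ^ 2 * t ^ 2 * K).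
    { apply Rmult_le_compat; try lra; nra. }
    assert (Q4 : 0 <= sin (1 * p * t) ^ 2 * cosh (2 * q * t)) by (apply Rmult_le_pos; nra).
    assert (0 <= t ^ 2) by nra.
    assert (0 <= Rabs p * Rabs q * K * t ^ 2) by (apply Rmult_le_pos; lra).
    assert (0 <= sinh (1 * q * t) ^ 2) by nra.
    unfold C0; apply Rabs_le; split; lra.
  - unfold cos2_im; rewrite Rabs_Ropp, Rabs_mult.
    assert (S1 := Hsn 2 ltac:(lra)); assert (S2 := Hsh 2 ltac:(lra)).
    apply Rle_trans with (2 * Rabs p * t * (2 * Rabs q * t * K)).
    + apply Rmult_le_compat; auto using Rabs_pos.
    + assert (0 <= t ^ 2) by nra.
      assert (0 <= p ^ 2 * K * t ^ 2) by (apply Rmult_le_pos; lra).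
      assert (0 <= q ^ 2 * K ^ 2 * t ^ 2) by (apply Rmult_le_pos; lra).
      unfold C0; lra.
Qed.

Definition wallis_ratio (p q : R) (n : nat) : C :=
  (wallis (cos2_re p q) (2 * n) / wallis1 (2 * n),
   wallis (cos2_im p q) (2 * n) / wallis1 (2 * n)).

Lemma wallis_ratio_cv (p q : R) :
  is_lim_seq (fun n => Re (wallis_ratio p q n)) 1 /\
  is_lim_seq (fun n => Im (wallis_ratio p q n)) 0.
Proof.
  set (C := 4 * (4 * Rabs p * Rabs q * exp (PI * Rabs q) + 2 * p ^ 2 * exp (PI * Rabs q)
                 + 2 * q ^ 2 * exp (PI * Rabs q) ^ 2)).
  assert (B := cos2_sub_1_bound p q).
  assert (L : is_lim_seq (fun n => C * / INR (2 * n + 2)) 0).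
  { replace (Finite 0) with (Rbar_mult C 0) by (simpl; f_equal; ring).
    apply is_lim_seq_scal_l.
    apply (is_lim_seq_inv _ p_infty); [| discriminate].
    apply is_lim_seq_le_p_loc with INR; [| apply is_lim_seq_INR].
    exists 0%nat; intros n _; apply le_INR; lia. }
  assert (G : forall f, (forall t, continuous f t) ->
    (forall t, 0 <= t <= PI / 2 -> Rabs (f t) <= C * sin t ^ 2) ->
    is_lim_seq (fun n => wallis f (2 * n) / wallis1 (2 * n)) 0).
  { intros f Hf Hb; apply is_lim_seq_abs_0.
    apply is_lim_seq_le_le with (u := fun _ => 0) (w := fun n => C * / INR (2 * n + 2));
      [| apply is_lim_seq_const | exact L].
    intros n; split; [apply Rabs_pos |].
    assert (W := wallis1_even_pos n).
    assert (A := wallis_bound f C (2 * n) Hf Hb).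
    assert (Hn := pos_INR (2 * n)).
    unfold Rdiv; rewrite Rabs_mult, (Rabs_pos_eq (/ _))
      by (left; now apply Rinv_0_lt_compat).
    apply Rle_div_l; [exact W |].
    replace (INR (2 * n + 2)) with (INR (2 * n) + 2) by (rewrite plus_INR; reflexivity).
    unfold Rdiv in A; lra. }
  split.
  - apply is_lim_seq_ext with (fun n =>
      wallis (fun t => 1 * cos2_re p q t + -1 * 1) (2 * n) / wallis1 (2 * n) + 1).
    + intros n; assert (W := wallis1_even_pos n).
      rewrite (wallis_linear (cos2_re p q) (fun _ => 1))
        by (intros; first [apply continuous_cos2_re | apply continuous_const]).
      fold wallis1; simpl; field; apply Rgt_not_eq, W.
    + replace (Finite 1) with (Finite (0 + 1)) by (f_equal; ring).
      apply is_lim_seq_plus'; [| apply is_lim_seq_const].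
      apply G.
      * intros t; apply (continuous_plus (V := R_NormedModule));
          [apply (continuous_scal_r (V := R_NormedModule)), continuous_cos2_re
          | apply continuous_const].
      * intros t Ht; replace (1 * cos2_re p q t + -1 * 1) with (cos2_re p q t - 1) by ring.
        now apply B.
  - apply G; [apply continuous_cos2_im | now apply B].
Qed.

(* The product of w + k over |k| <= n. *)
Fixpoint sine_prod (w : C) (n : nat) : C :=
  match n with
  | O => w
  | S m => Cmult (sine_prod w m)
             (Cmult (Cplus w (RtoC (INR (S m)))) (Cminus w (RtoC (INR (S m)))))
  end.

(** This is pi (-1)^n / (n!)^2, which turns the product of w + k over |k| <= n into pi w times the
    product of 1 - w^2 / k^2. It is real, so it adds no angle to a quotient of two sines. *)
Fixpoint sine_coef (n : nat) : R :=
  match n with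
  | O => PI
  | S m => - sine_coef m / INR (S m) ^ 2
  end.

Lemma wallis_ratio_rec (p q : R) (n : nat) :
  Cmult (Cmult (Cplus (p, q) (RtoC (INR (S n)))) (Cminus (p, q) (RtoC (INR (S n)))))
        (wallis_ratio p q (S n)) =
  Cmult (RtoC (- INR (S n) ^ 2)) (wallis_ratio p q n).
Proof.
  unfold wallis_ratio.
  replace (2 * S n)%nat with (S (S (2 * n))) by lia.
  assert (R1 := wallis_re_rec p q (2 * n)).
  assert (R2 := wallis_im_rec p q (2 * n)).
  assert (R3 := wallis1_rec (2 * n)).
  assert (W0 := wallis1_even_pos n).
  assert (W1 := wallis1_even_pos (S n)).
  replace (2 * S n)%nat with (S (S (2 * n))) in W1 by lia.
  rewrite mult_INR in *; replace (INR 2) with 2 in * by (simpl; ring).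
  rewrite S_INR; assert (Hn := pos_INR n).
  set (x := INR n) in *.
  set (A' := wallis (cos2_re p q) (S (S (2 * n)))) in *.
  set (B' := wallis (cos2_im p q) (S (S (2 * n)))) in *.
  set (W' := wallis1 (S (S (2 * n)))) in *.
  set (A := wallis (cos2_re p q) (2 * n)) in *.
  set (B := wallis (cos2_im p q) (2 * n)) in *.
  set (W := wallis1 (2 * n)) in *.
  clearbody A' B' W' A B W x.
  (* Solving the recurrences for the integrals of lower index leaves a rational identity. *)
  assert (EW : W = (2 * x + 2) * W' / (2 * x + 1))
    by (apply (Rmult_eq_reg_l (2 * x + 1)); [rewrite <- R3; field | ]; lra).
  assert (EA : A = - ((4 * (p ^ 2 - q ^ 2) - (2 * x + 2) ^ 2) * A' + 4 * - (2 * p * q) * B')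
                   / ((2 * x + 2) * (2 * x + 1))).
  { apply (Rmult_eq_reg_l ((2 * x + 2) * (2 * x + 1))); [| nra].
    replace ((2 * x + 2) * (2 * x + 1) * A) with
      (- ((4 * (p ^ 2 - q ^ 2) - (2 * x + 2) ^ 2) * A' + 4 * - (2 * p * q) * B')) by lra.
    field; lra. }
  assert (EB : B = - ((4 * (p ^ 2 - q ^ 2) - (2 * x + 2) ^ 2) * B' + 4 * (2 * p * q) * A')
                   / ((2 * x + 2) * (2 * x + 1))).
  { apply (Rmult_eq_reg_l ((2 * x + 2) * (2 * x + 1))); [| nra].
    replace ((2 * x + 2) * (2 * x + 1) * B) with
      (- ((4 * (p ^ 2 - q ^ 2) - (2 * x + 2) ^ 2) * B' + 4 * (2 * p * q) * A')) by lra.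
    field; lra. }
  unfold Cmult, Cplus, Cminus, Copp, RtoC; simpl fst; simpl snd.
  rewrite EA, EB, EW.
  unfold Cplus; simpl fst; simpl snd; f_equal; field; lra.
Qed.

Lemma wallis_sin2 (f g S : R -> R) (a b : R) :
  (forall t, continuous f t) -> (forall t, continuous g t) ->
  (forall t, is_derive S t (2 * (a * f t + b * g t))) -> S 0 = 0 ->
  2 * (a * wallis f 0 + b * wallis g 0) = S (PI / 2).
Proof.
  intros Hf Hg HS H0.
  transitivity (2 * a * wallis f 0 + 2 * b * wallis g 0); [ring |].
  rewrite <- (wallis_linear f g (2 * a) (2 * b) 0 Hf Hg).
  rewrite <- (Rminus_0_r (S (PI / 2))), <- H0.
  apply (is_RInt_unique (V := R_CompleteNormedModule)).
  apply (is_RInt_ext (V := R_NormedModule)) with (fun t => 2 * (a * f t + b * g t)).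
  { intros t _; match goal with |- ?x = ?y => change (@eq R x y) end; simpl; ring. }
  apply (is_RInt_derive (V := R_CompleteNormedModule) S).
  - intros t _; apply HS.
  - intros t _; apply (continuous_scal_r (V := R_NormedModule)),
      (continuous_plus (V := R_NormedModule));
      apply (continuous_scal_r (V := R_NormedModule)); auto.
Qed.

(** Each new factor of the product is absorbed by the recurrence of [wallis_ratio], so the identity
    is exact for every n, and Euler's product is its limit. *)
Lemma sine_prod_wallis (p q : R) (n : nat) :
  Cmult (Cmult (RtoC (sine_coef n)) (sine_prod (p, q) n)) (wallis_ratio p q n)
  = Csin (Cmult (RtoC PI) (p, q)).
Proof.
  induction n as [| n IH].
  - assert (HP := PI_RGT_0).
    assert (E1 : 2 * (p * wallis (cos2_re p q) 0 + - q * wallis (cos2_im p q) 0)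
                 = sin2_re p q (PI / 2)).
    { apply wallis_sin2; try apply continuous_cos2_re; try apply continuous_cos2_im.
      - intros t; replace (p * cos2_re p q t + - q * cos2_im p q t)
          with (p * cos2_re p q t - q * cos2_im p q t) by ring; apply is_derive_sin2_re.
      - unfold sin2_re; rewrite Rmult_0_r, sin_0; ring. }
    assert (E2 : 2 * (p * wallis (cos2_im p q) 0 + q * wallis (cos2_re p q) 0)
                 = sin2_im p q (PI / 2)).
    { apply wallis_sin2; try apply continuous_cos2_re; try apply continuous_cos2_im.
      - apply is_derive_sin2_im.
      - unfold sin2_im; rewrite !Rmult_0_r, sinh_0; ring. }
    unfold sin2_re, sin2_im in *.
    replace (2 * p * (PI / 2)) with (PI * p) in * by field.
    replace (2 * q * (PI / 2)) with (PI * q) in * by field.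
    rewrite Csin_PI, <- E1, <- E2.
    unfold wallis_ratio; change (2 * 0)%nat with 0%nat; rewrite wallis1_0.
    unfold Cmult, RtoC; simpl; f_equal; field; lra.
  - rewrite <- IH.
    change (sine_prod (p, q) (S n)) with (Cmult (sine_prod (p, q) n)
      (Cmult (Cplus (p, q) (RtoC (INR (S n)))) (Cminus (p, q) (RtoC (INR (S n)))))).
    rewrite Cmult_assoc, <- Cmult_assoc, wallis_ratio_rec.
    change (sine_coef (S n)) with (- sine_coef n / INR (S n) ^ 2).
    replace (sine_coef n) with (- sine_coef n / INR (S n) ^ 2 * - INR (S n) ^ 2) at 2
      by (field; apply not_0_INR; lia).
    rewrite RtoC_mult; ring.
Qed.

(** * Comparison of arguments *)

(** Dividing by xi rather than by u makes this angle smooth on the whole line, with no case split at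
    u <= 0. *)
Definition theta (xi u : R) : R := PI / 2 - atan (u / xi).

Lemma theta_bound (xi u : R) : 0 < theta xi u < PI.
Proof. unfold theta; assert (H := atan_bound (u / xi)); lra. Qed.

Lemma theta_decr (xi u v : R) : 0 < xi -> u < v -> theta xi v < theta xi u.
Proof.
  intros Hxi Huv; unfold theta.
  assert (atan (u / xi) < atan (v / xi)); [| lra].
  apply atan_increasing, Rmult_lt_compat_r; [now apply Rinv_0_lt_compat | exact Huv].
Qed.

Lemma theta_opp (xi u : R) : theta xi (- u) = PI - theta xi u.
Proof. unfold theta; rewrite Rdiv_opp_l, atan_opp; field. Qed.

Lemma theta_atan (xi u : R) : 0 < xi -> 0 < u -> theta xi u = atan (xi / u).
Proof.
  intros Hxi Hu; unfold theta.
  rewrite <- atan_inv by now apply Rdiv_lt_0_compat.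
  f_equal; field; lra.
Qed.

Lemma lower_half_plane_polar (u xi : R) : 0 < xi ->
  exists r, 0 <= r /\ (u, - xi) = polar r (- theta xi u).
Proof.
  intros Hxi; exists (xi * sqrt (1 + (u / xi)²)); split.
  { apply Rmult_le_pos; [lra | apply sqrt_pos]. }
  unfold polar, theta; rewrite cos_neg, sin_neg, cos_shift, sin_shift, sin_atan, cos_atan.
  assert (0 < sqrt (1 + (u / xi)²)) by (apply sqrt_lt_R0; generalize (Rle_0_sqr (u / xi)); lra).
  f_equal; field; lra.
Qed.

Fixpoint sine_arg (xi p : R) (n : nat) : R :=
  match n with
  | O => theta xi p
  | S m => sine_arg xi p m + (theta xi (p + INR (S m)) + theta xi (p - INR (S m)))
  end.

Lemma sine_prod_polar (xi p : R) (n : nat) : 0 < xi ->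
  exists r, 0 <= r /\ sine_prod (p, - xi) n = polar r (- sine_arg xi p n).
Proof.
  intros Hxi; induction n as [| n [r [Hr IH]]].
  - now apply lower_half_plane_polar.
  - destruct (lower_half_plane_polar (p + INR (S n)) xi Hxi) as [r1 [H1 E1]].
    destruct (lower_half_plane_polar (p - INR (S n)) xi Hxi) as [r2 [H2 E2]].
    exists (r * (r1 * r2)); split; [repeat apply Rmult_le_pos; assumption |].
    cbn [sine_prod sine_arg]; rewrite IH.
    replace (Cplus (p, - xi) (RtoC (INR (S n)))) with (p + INR (S n), - xi)
      by (unfold Cplus, RtoC; simpl fst; simpl snd; f_equal; ring).
    replace (Cminus (p, - xi) (RtoC (INR (S n)))) with (p - INR (S n), - xi)
      by (unfold Cminus, Cplus, Copp, RtoC; simpl fst; simpl snd; f_equal; ring).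
    rewrite E1, E2, !polar_mult; f_equal; ring.
Qed.

Definition gap (xi alpha u : R) : R := theta xi u - theta xi (u + alpha).

Lemma gap_reflect (xi alpha u : R) : gap xi alpha (- u - alpha) = gap xi alpha u.
Proof.
  unfold gap; replace (- u - alpha + alpha) with (- u) by ring.
  replace (- u - alpha) with (- (u + alpha)) by ring.
  rewrite !theta_opp; ring.
Qed.

Lemma gap_pos (xi alpha u : R) : 0 < xi -> 0 < alpha -> 0 < gap xi alpha u.
Proof.
  intros Hxi Ha; unfold gap.
  assert (H := theta_decr xi u (u + alpha) Hxi ltac:(lra)); lra.
Qed.

Lemma is_derive_gap (xi alpha u : R) : 0 < xi ->
  is_derive (gap xi alpha) u
    (xi / ((u + alpha) ^ 2 + xi ^ 2) - xi / (u ^ 2 + xi ^ 2)).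
Proof.
  intros Hxi; unfold gap, theta.
  auto_derive; [exact I |].
  assert (A := pow2_ge_0 u); assert (B := pow2_ge_0 (u + alpha));
    assert (D := pow_lt xi 2 Hxi).
  field; repeat split; lra.
Qed.

(* The derivative of [theta] is even and unimodal, so the drop of [theta] over a
   window of fixed width depends only on, and decreases with, the distance of its
   centre to the origin. *)
Lemma gap_decr (xi alpha u v : R) : 0 < xi -> 0 < alpha -> u < v -> 0 < u + v + alpha ->
  gap xi alpha v < gap xi alpha u.
Proof.
  intros Hxi Ha.
  assert (W : forall u v, 0 <= 2 * u + alpha -> u < v -> gap xi alpha v < gap xi alpha u).
  { clear u v; intros u v Hu Huv.
    destruct (mean_value (gap xi alpha)
      (fun u => xi / ((u + alpha) ^ 2 + xi ^ 2) - xi / (u ^ 2 + xi ^ 2)) u v Huv)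
      as [c [Hc E]].
    { intros c _; now apply is_derive_gap. }
    cbv beta in E.
    assert (xi / ((c + alpha) ^ 2 + xi ^ 2) < xi / (c ^ 2 + xi ^ 2)); [| nra].
    assert (0 < c ^ 2 + xi ^ 2) by nra.
    assert (c ^ 2 + xi ^ 2 < (c + alpha) ^ 2 + xi ^ 2) by nra.
    apply Rmult_lt_compat_l; [lra |].
    apply Rinv_lt_contravar; [apply Rmult_lt_0_compat |]; lra. }
  intros Huv Hs; destruct (Rle_or_lt 0 (2 * u + alpha)) as [H | H]; [now apply W |].
  (* The window at u is centred left of 0; its mirror image has the same drop and is still nearer to
     0 than the window at v. *)
  rewrite <- (gap_reflect xi alpha u); apply W; lra.
Qed.

Lemma theta_cv_0 (xi c : R) : 0 < xi -> is_lim_seq (fun n => theta xi (c + INR n)) 0.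
Proof.
  intros Hxi.
  assert (L : is_lim_seq (fun n => c + INR n) p_infty).
  { eapply is_lim_seq_plus; [apply is_lim_seq_const | apply is_lim_seq_INR |].
    reflexivity. }
  apply is_lim_seq_le_le_loc with (u := fun _ => 0) (w := fun n => xi * / (c + INR n)).
  - destruct (proj2 (is_lim_seq_spec _ _) L 0) as [N HN].
    exists N; intros n Hn; specialize (HN n Hn); simpl in HN.
    split; [left; apply theta_bound |].
    rewrite theta_atan by lra.
    apply atan_le_id; left; now apply Rdiv_lt_0_compat.
  - apply is_lim_seq_const.
  - replace (Finite 0) with (Rbar_mult xi 0) by (simpl; f_equal; ring).
    apply is_lim_seq_scal_l, (is_lim_seq_inv _ p_infty L); discriminate.
Qed.

Lemma gap_cv_0 (xi alpha c : R) : 0 < xi ->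
  is_lim_seq (fun n => gap xi alpha (c + INR n)) 0.
Proof.
  intros Hxi; unfold gap.
  replace (Finite 0) with (Finite (0 - 0)) by (f_equal; ring).
  apply is_lim_seq_minus'; [now apply theta_cv_0 |].
  apply is_lim_seq_ext with (fun n => theta xi (c + alpha + INR n)).
  - intros n; f_equal; ring.
  - now apply theta_cv_0.
Qed.

(** Here p = 1 - tau + alpha. The windows starting at p - 1 + m survive from the sine quotient,
    those starting at 2 - p + m from the Gamma quotient. *)
Definition arg_defect (xi alpha p : R) (n : nat) : R :=
  sum_f_R0 (fun m => gap xi alpha (p - 1 + INR m) - gap xi alpha (2 - p + INR m)) n.

(** The condition p < 3/2 puts p - 1 to the left of 2 - p, so every term is positive by [gap_decr].
    For the upper bound the subtracted drops are discarded: windows of width alpha < 1 at unit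
    spacing are disjoint, hence their drops add up to less than theta(p - 1) < pi. *)
Lemma arg_defect_cv (xi alpha p : R) : 0 < xi -> 0 < alpha < 1 -> p < 3 / 2 ->
  exists E, 0 < E < PI /\ is_lim_seq (arg_defect xi alpha p) E.
Proof.
  intros Hxi Ha Hp.
  assert (Hpos : forall m, 0 < gap xi alpha (p - 1 + INR m) - gap xi alpha (2 - p + INR m)).
  { intros m; assert (Hm := pos_INR m).
    assert (H := gap_decr xi alpha (p - 1 + INR m) (2 - p + INR m) Hxi
                   ltac:(lra) ltac:(lra) ltac:(lra)); lra. }
  assert (Hub : forall n, arg_defect xi alpha p n
                <= theta xi (p - 1) - theta xi (p + INR n)).
  { intros n; unfold arg_defect; induction n as [| n IH].
    - cbn [sum_f_R0 INR]; rewrite !Rplus_0_r.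
      assert (A := gap_pos xi alpha (2 - p) Hxi ltac:(lra)).
      unfold gap in *.
      assert (B := theta_decr xi (p - 1 + alpha) p Hxi ltac:(lra)); lra.
    - rewrite tech5.
      assert (A := gap_pos xi alpha (2 - p + INR (S n)) Hxi ltac:(lra)).
      unfold gap in *.
      assert (B := theta_decr xi (p - 1 + INR (S n) + alpha) (p + INR (S n)) Hxi
                     ltac:(lra)).
      replace (theta xi (p - 1 + INR (S n))) with (theta xi (p + INR n))
        by (rewrite S_INR; f_equal; ring).
      lra. }
  assert (Hinc : forall n, arg_defect xi alpha p n <= arg_defect xi alpha p (S n)).
  { intros n; unfold arg_defect; rewrite tech5; specialize (Hpos (S n)); lra. }
  assert (Hub' : forall n, arg_defect xi alpha p n <= theta xi (p - 1)).
  { intros n; assert (A := theta_bound xi (p + INR n)); specialize (Hub n); lra. }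
  destruct (ex_finite_lim_seq_incr _ _ Hinc Hub') as [E HE].
  exists E; split; [split |].
  (* The limit of the increasing sums is at least the first term, which keeps positivity strict. *)
  - assert (A := is_lim_seq_incr_compare _ _ HE Hinc 0).
    assert (B := Hpos 0%nat).
    unfold arg_defect in A; cbn [sum_f_R0] in A; lra.
  - apply Rle_lt_trans with (theta xi (p - 1)); [| apply theta_bound].
    apply (is_lim_seq_le _ _ (Finite _) (Finite _) Hub' HE), is_lim_seq_const.
  - exact HE.
Qed.

(* Pairing the factors of the sine quotient with those of the Gamma quotient leaves
   [arg_defect] up to boundary terms that vanish in the limit. *)
Lemma sine_arg_sub (xi alpha p : R) (n : nat) :
  0 < xi -> 0 < alpha -> p + alpha < 2 ->
  sine_arg xi p n - sine_arg xi (p + alpha) n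
  + (lgarg (2 - p - alpha) xi n - lgarg (2 - p - alpha + 2 * alpha) xi n) =
  arg_defect xi alpha p n + gap xi alpha (p + INR n)
  - gap xi alpha (2 - p - alpha + INR n) - gap xi alpha (1 - p - alpha + INR n).
Proof.
  intros Hxi Ha Hp; unfold lgarg, arg_defect.
  assert (S1 : forall c n, 0 < c ->
    sum_f_R0 (fun k => atan (xi / (c + INR k))) n
    = sum_f_R0 (fun k => theta xi (c + INR k)) n).
  { intros c m Hc; apply sum_eq; intros k _; assert (Hk := pos_INR k).
    symmetry; apply theta_atan; lra. }
  rewrite !S1 by lra.
  induction n as [| n IH].
  - cbn [sine_arg sum_f_R0 INR]; rewrite !Rplus_0_r.
    assert (G := gap_reflect xi alpha (p - 1)).
    replace (- (p - 1) - alpha) with (1 - p - alpha) in G by ring.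
    rewrite G; unfold gap.
    replace (2 - p - alpha + alpha) with (2 - p) by ring.
    replace (2 - p - alpha + 2 * alpha) with (2 - p + alpha) by ring.
    ring.
  - rewrite !tech5; cbn [sine_arg].
    (* Reflection moves the window of the sine factor p - k to k - p - alpha, where it meets a
       window of the Gamma quotient shifted by 2. These windows cancel between successive n, which
       is why only boundary terms remain. *)
    assert (G := gap_reflect xi alpha (p - INR (S n))).
    rewrite !S_INR in *; set (x := INR n) in *.
    replace (- (p - (x + 1)) - alpha) with (1 - p - alpha + x) in G by ring.
    replace (p - 1 + (x + 1)) with (p + x) by ring.
    replace (1 - p - alpha + (x + 1)) with (2 - p - alpha + x) by ring.
    unfold gap in *.
    replace (p + alpha - (x + 1)) with (p - (x + 1) + alpha) by ring.
    replace (p + alpha + (x + 1)) with (p + (x + 1) + alpha) by ring.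
    replace (2 - p - alpha + (x + 1) + alpha) with (2 - p + (x + 1)) by ring.
    replace (2 - p - alpha + 2 * alpha + (x + 1)) with (2 - p + (x + 1) + alpha) by ring.
    lra.
Qed.

(** * The argument of [T_s] as a limit *)

Lemma ray_limit (V : C) (delta : nat -> R) (d : R) (J : nat -> C) :
  is_lim_seq delta d ->
  (forall n, exists r, 0 <= r /\
     Cmult V (polar 1 (delta n)) = Cmult (RtoC r) (J n)) ->
  is_lim_seq (fun n => Re (J n)) 1 -> is_lim_seq (fun n => Im (J n)) 0 ->
  exists z, 0 <= z /\ V = polar z (- d).
Proof.
  intros Hd E J1 J0; destruct V as [v1 v2].
  assert (Lc := is_lim_seq_cos _ _ Hd); assert (Ls := is_lim_seq_sin _ _ Hd).
  set (X := fun n => v1 * cos (delta n) - v2 * sin (delta n)).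
  set (Y := fun n => v1 * sin (delta n) + v2 * cos (delta n)).
  (* These two relations say that V rotated by delta n lies on the ray of J n, but no longer mention
     the factor r, so they pass to the limit without any control of it. *)
  assert (HXY : forall n, 0 <= X n * Re (J n) /\ X n * Im (J n) = Y n * Re (J n)).
  { intros n; destruct (E n) as [r [Hr En]].
    assert (EX : X n = r * Re (J n)).
    { apply (f_equal Re) in En.
      unfold X, Cmult, polar, RtoC, Re in *; simpl in *; lra. }
    assert (EY : Y n = r * Im (J n)).
    { apply (f_equal Im) in En.
      unfold Y, Cmult, polar, RtoC, Im in *; simpl in *; lra. }
    rewrite EX, EY; split; [| ring].
    rewrite Rmult_assoc; apply Rmult_le_pos; [exact Hr | apply Rle_0_sqr]. }
  set (z := v1 * cos d - v2 * sin d); set (y := v1 * sin d + v2 * cos d).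
  assert (Lz : is_lim_seq X z).
  { apply is_lim_seq_minus'; now apply (is_lim_seq_scal_l _ _ (Finite _)). }
  assert (Ly : is_lim_seq Y y).
  { apply is_lim_seq_plus'; now apply (is_lim_seq_scal_l _ _ (Finite _)). }
  assert (Hz : 0 <= z).
  { replace z with (z * 1) by ring.
    apply (is_lim_seq_le (fun _ => 0) (fun n => X n * Re (J n)) (Finite _) (Finite _)).
    - apply HXY.
    - apply is_lim_seq_const.
    - now apply is_lim_seq_mult'. }
  assert (Hy : y = 0).
  { assert (A := is_lim_seq_mult' _ _ _ _ Ly J1).
    assert (B := is_lim_seq_mult' _ _ _ _ Lz J0).
    apply is_lim_seq_ext with (v := fun n => Y n * Re (J n)) in B; [| apply HXY].
    apply is_lim_seq_unique in A; apply is_lim_seq_unique in B.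
    rewrite A in B; injection B; lra. }
  exists z; split; [exact Hz |].
  assert (T := sin2_cos2 d); unfold Rsqr in T.
  unfold polar; rewrite cos_neg, sin_neg; f_equal.
  - transitivity (v1 * (sin d * sin d + cos d * cos d)); [rewrite T; ring |].
    transitivity (z * cos d + y * sin d); [unfold z, y; ring | rewrite Hy; ring].
  - transitivity (v2 * (sin d * sin d + cos d * cos d)); [rewrite T; ring |].
    transitivity (z * - sin d + y * cos d); [unfold z, y; ring | rewrite Hy; ring].
Qed.

Lemma Cmult_conj_polar (r s phi psi : R) :
  Cmult (polar r phi) (Cconj (polar s psi)) = polar (r * s) (phi - psi).
Proof.
  replace (Cconj (polar s psi)) with (polar s (- psi));
    [now rewrite polar_mult |].
  unfold Cconj, polar; simpl; rewrite cos_neg, sin_neg; f_equal; ring.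
Qed.

Lemma Csin_PI_neq_0 (p xi : R) : 0 < xi -> Csin (Cmult (RtoC PI) (p, - xi)) <> 0%C.
Proof.
  intros Hxi E.
  assert (H := Cmod_Csin_PI p (- xi)); rewrite E, Cmod_0 in H.
  assert (A := sinh_pos (PI * xi) ltac:(apply Rmult_lt_0_compat; [apply PI_RGT_0 | lra])).
  rewrite Ropp_mult_distr_r_reverse, sinh_neg in H.
  symmetry in H; apply sqrt_eq_0 in H; nra.
Qed.

Lemma T_s_polar (alpha tau xi : R) : 0 < alpha < 1 -> 1 < tau < 2 -> 0 < xi ->
  exists r E, 0 < r /\ 0 < E < PI /\
    T_s alpha tau xi = polar r (T_B_arg alpha tau xi - E).
Proof.
  intros Ha Ht Hxi.
  set (p := 1 - tau + alpha).
  destruct (arg_defect_cv xi alpha p Hxi Ha ltac:(unfold p; lra)) as [E [HE LE]].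
  set (U1 := Csin (Cmult (RtoC PI) (p, - xi))).
  set (U2 := Csin (Cmult (RtoC PI) (p + alpha, - xi))).
  assert (H1 : U1 <> 0%C) by now apply Csin_PI_neq_0.
  assert (H2 : U2 <> 0%C) by now apply Csin_PI_neq_0.
  set (delta := fun n => sine_arg xi p n - sine_arg xi (p + alpha) n).
  assert (Ld : is_lim_seq delta (E - T_B_arg alpha tau xi)).
  { apply is_lim_seq_ext with (fun n =>
      (arg_defect xi alpha p n + gap xi alpha (p + INR n)
       - gap xi alpha (2 - p - alpha + INR n) - gap xi alpha (1 - p - alpha + INR n))
      - (lgarg (2 - p - alpha) xi n - lgarg (2 - p - alpha + 2 * alpha) xi n)).
    { intros n; rewrite <- sine_arg_sub by (unfold p; lra); unfold delta; ring. }
    replace (Finite (E - T_B_arg alpha tau xi)) with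
      (Finite (E + 0 - 0 - 0 - T_B_arg alpha tau xi)) by (f_equal; ring).
    apply is_lim_seq_minus'.
    - apply is_lim_seq_minus';
        [apply is_lim_seq_minus'; [apply is_lim_seq_plus'; [exact LE |] |] |];
        now apply gap_cv_0.
    - unfold T_B_arg.
      replace (tau - 2 * alpha + 1) with (2 - p - alpha) by (unfold p; ring).
      apply is_lim_seq_minus'; apply is_lim_lgarg; unfold p; lra. }
  destruct (wallis_ratio_cv p (- xi)) as [A1 B1].
  destruct (wallis_ratio_cv (p + alpha) (- xi)) as [A2 B2].
  assert (B2' : is_lim_seq (fun n => - Im (wallis_ratio (p + alpha) (- xi) n)) (- 0))
    by exact (proj1 (is_lim_seq_opp _ (Finite 0)) B2).
  (* Working with U1 times the conjugate of U2, which has the argument of U1 / U2, keeps the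
     approximations free of division. *)
  set (J := fun n => Cmult (wallis_ratio p (- xi) n)
                       (Cconj (wallis_ratio (p + alpha) (- xi) n))).
  assert (Hn : forall n, exists r, 0 <= r /\
    Cmult (Cmult U1 (Cconj U2)) (polar 1 (delta n)) = Cmult (RtoC r) (J n)).
  { intros n.
    destruct (sine_prod_polar xi p n Hxi) as [r1 [Hr1 E1]].
    destruct (sine_prod_polar xi (p + alpha) n Hxi) as [r2 [Hr2 E2]].
    exists (sine_coef n * sine_coef n * (r1 * r2)); split.
    { apply Rmult_le_pos; [apply Rle_0_sqr | now apply Rmult_le_pos]. }
    unfold U1, U2; rewrite <- (sine_prod_wallis p (- xi) n),
      <- (sine_prod_wallis (p + alpha) (- xi) n), E1, E2.
    rewrite !RtoC_polar, !polar_mult, Cmult_conj.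
    transitivity (Cmult (Cmult (Cmult
      (polar (sine_coef n * r1) (0 + - sine_arg xi p n))
      (Cconj (polar (sine_coef n * r2) (0 + - sine_arg xi (p + alpha) n))))
      (polar 1 (delta n))) (J n)).
    { unfold J; ring. }
    rewrite Cmult_conj_polar, polar_mult.
    f_equal; f_equal; unfold delta; ring. }
  destruct (ray_limit (Cmult U1 (Cconj U2)) delta (E - T_B_arg alpha tau xi)
    J Ld Hn) as [z [Hz EV]].
  - replace (Finite 1) with (Finite (1 * 1 - 0 * - 0)) by (f_equal; ring).
    unfold J, Cmult, Cconj, Re in *; simpl.
    apply is_lim_seq_minus'; apply is_lim_seq_mult'; auto.
  - replace (Finite 0) with (Finite (1 * - 0 + 0 * 1)) by (f_equal; ring).
    unfold J, Cmult, Cconj, Re, Im in *; simpl.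
    apply is_lim_seq_plus'; apply is_lim_seq_mult'; auto.
  - assert (M1 := proj1 (Cmod_gt_0 U1) H1); assert (M2 := proj1 (Cmod_gt_0 U2) H2).
    assert (H3 : Cconj U2 <> 0%C) by (apply Cmod_gt_0; now rewrite Cmod_conj).
    assert (Ez : 0 < Rabs z).
    { rewrite <- (Cmod_polar z (- (E - T_B_arg alpha tau xi))), <- EV, Cmod_mult, Cmod_conj.
      now apply Rmult_lt_0_compat. }
    rewrite Rabs_pos_eq in Ez by exact Hz.
    exists (z / Cmod U2 ^ 2), E; split; [| split; [exact HE |]].
    { apply Rdiv_lt_0_compat; [lra | now apply pow_lt]. }
    replace (T_s alpha tau xi) with (Cmult (RtoC (/ Cmod U2 ^ 2)) (Cmult U1 (Cconj U2))).
    + rewrite EV, RtoC_polar, polar_mult; f_equal; [field; lra | ring].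
    + unfold T_s; fold p; replace (1 - tau + 2 * alpha) with (p + alpha)
        by (unfold p; ring).
      fold U1 U2.
      assert (EC := Cmod2_conj U2).
      rewrite RtoC_inv, EC by (apply pow_nonzero; lra).
      field; split; assumption.
Qed.

(** * Principal arguments *)

Lemma polar_add_PI (r phi : R) : polar r (phi + PI) = Copp (polar r phi).
Proof. unfold polar, Copp; simpl; rewrite neg_cos, neg_sin; f_equal; ring. Qed.

Lemma polar_sub_PI (r phi : R) : polar r (phi - PI) = Copp (polar r phi).
Proof.
  replace (polar r phi) with (polar r (phi - PI + PI)) by (f_equal; ring).
  rewrite polar_add_PI; ring.
Qed.

Lemma Carg_polar (z : C) : z <> 0%C -> exists r, 0 < r /\ z = polar r (Carg z).
Proof.
  destruct z as [x y]; intros Hz; unfold Carg; simpl Re; simpl Im; cbv zeta.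
  destruct (Rlt_dec 0 x) as [Hx | Hx].
  { eexists; split; [apply exp_pos | now apply right_half_plane_polar]. }
  destruct (Rlt_dec x 0) as [Hx' | Hx'].
  - assert (E := right_half_plane_polar (- x) (- y) ltac:(lra)).
    replace (- y / - x) with (y / x) in E by (field; lra).
    assert (E' : (x, y) = Copp (- x, - y))
      by (unfold Copp; simpl; now rewrite !Ropp_involutive).
    eexists; split; [apply exp_pos |].
    destruct (Rle_dec 0 y); rewrite ?polar_add_PI, ?polar_sub_PI, E', E; reflexivity.
  - replace x with 0 in * by lra.
    destruct (Rlt_dec 0 y) as [Hy | Hy].
    { exists y; split; [exact Hy |].
      unfold polar; rewrite cos_PI2, sin_PI2; f_equal; ring. }
    destruct (Rlt_dec y 0) as [Hy' | Hy'].
    { exists (- y); split; [lra |].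
      unfold polar; rewrite cos_neg, sin_neg, cos_PI2, sin_PI2; f_equal; ring. }
    exfalso; apply Hz; replace y with 0 by lra; reflexivity.
Qed.

Lemma polar_neq_0 (r phi : R) : 0 < r -> polar r phi <> 0%C.
Proof. intros Hr; apply Cmod_gt_0; rewrite Cmod_polar, Rabs_pos_eq; lra. Qed.

(** Equal arguments would make T_s times the conjugate of T_B real, but that product has angle - E
    with 0 < E < pi. This one statement covers both (c) and (d). *)
Lemma T_s_T_B_arg_neq (alpha tau xi : R) : 0 < alpha < 1 -> 1 < tau < 2 -> 0 < xi ->
  Carg (T_s alpha tau xi) <> Carg (T_B alpha tau xi).
Proof.
  intros Ha Ht Hxi EC.
  destruct (T_s_polar alpha tau xi Ha Ht Hxi) as [r [E [Hr [HE Es]]]].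
  assert (EB := T_B_polar alpha tau xi Ha ltac:(lra) ltac:(lra)).
  assert (Hm := T_B_mod_pos alpha tau xi Ha).
  destruct (Carg_polar (T_s alpha tau xi)) as [r1 [Hr1 E1]];
    [rewrite Es; now apply polar_neq_0 |].
  destruct (Carg_polar (T_B alpha tau xi)) as [r2 [Hr2 E2]];
    [rewrite EB; now apply polar_neq_0 |].
  assert (H : Im (Cmult (T_s alpha tau xi) (Cconj (T_B alpha tau xi))) = 0).
  { rewrite E1, E2, EC, Cmult_conj_polar, Rminus_diag.
    unfold polar; simpl; rewrite sin_0; ring. }
  rewrite Es, EB, Cmult_conj_polar in H.
  replace (T_B_arg alpha tau xi - E - T_B_arg alpha tau xi) with (- E) in H by ring.
  unfold polar in H; simpl in H; rewrite sin_neg in H.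
  assert (0 < sin E) by (apply sin_gt_0; lra).
  assert (0 < r * T_B_mod alpha tau xi * sin E) by (apply Rmult_lt_0_compat; [now apply Rmult_lt_0_compat | assumption]).
  lra.
Qed.

(** * Conjugation symmetry *)

(** Including z = 0, by the convention for inverses, spares the conjugation lemmas every check that
    a denominator is nonzero. *)
Lemma Cinv_conj_total (z : C) : Cconj (Cinv z) = Cinv (Cconj z).
Proof.
  destruct z as [x y]; unfold Cconj, Cinv; cbn [fst snd].
  replace ((- y) ^ 2) with (y ^ 2) by ring.
  unfold Rdiv; f_equal; ring.
Qed.

Lemma Cdiv_conj_total (z w : C) : Cconj (Cdiv z w) = Cdiv (Cconj z) (Cconj w).
Proof. unfold Cdiv; now rewrite Cmult_conj, Cinv_conj_total. Qed.

Lemma RtoC_conj (r : R) : Cconj (RtoC r) = RtoC r.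
Proof. unfold Cconj, RtoC; simpl; now rewrite Ropp_0. Qed.

Lemma Csin_conj (z : C) : Csin (Cconj z) = Cconj (Csin z).
Proof.
  unfold Csin, Cconj, Re, Im; simpl; rewrite cosh_neg, sinh_neg; f_equal; ring.
Qed.

Lemma Cpoch_conj (z : C) (n : nat) : Cpoch (Cconj z) n = Cconj (Cpoch z n).
Proof.
  induction n as [| n IH]; [reflexivity |].
  cbn [Cpoch]; now rewrite IH, Cmult_conj, Cplus_conj, RtoC_conj.
Qed.

Lemma gauss_seq_conj (z : C) (n : nat) : gauss_seq (Cconj z) n = Cconj (gauss_seq z n).
Proof.
  unfold gauss_seq; rewrite Cdiv_conj_total, Cmult_conj, RtoC_conj, Cpoch_conj.
  do 2 f_equal; unfold Cnatpow, Cexp, Cconj, Cmult, RtoC, Re, Im; simpl.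
  replace (fst z * ln (INR n) - - snd z * 0) with (fst z * ln (INR n) - snd z * 0) by ring.
  replace (fst z * 0 + - snd z * ln (INR n)) with (- (fst z * 0 + snd z * ln (INR n)))
    by ring.
  rewrite cos_neg, sin_neg; f_equal; ring.
Qed.

Lemma CGamma_conj (z : C) : CGamma (Cconj z) = Cconj (CGamma z).
Proof.
  unfold CGamma, Cconj at 3; simpl fst; simpl snd; f_equal.
  - f_equal; apply Lim_seq_ext; intros n; now rewrite gauss_seq_conj, re_conj.
  - rewrite (Lim_seq_ext _ (fun n => - Im (gauss_seq z n)))
      by (intros n; now rewrite gauss_seq_conj, im_conj).
    (* An infinite limit has real part 0 by default, which negation preserves, so no convergence is
       assumed here. *)
    rewrite Lim_seq_opp; destruct (Lim_seq _); simpl; ring.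
Qed.

Lemma T_B_conj (alpha tau xi : R) : T_B alpha tau (- xi) = Cconj (T_B alpha tau xi).
Proof.
  unfold T_B, CBeta.
  change (tau - 2 * alpha + 1, - xi) with (Cconj (tau - 2 * alpha + 1, xi)).
  rewrite Cmult_conj, RtoC_conj, Cdiv_conj_total, Cmult_conj.
  rewrite <- !CGamma_conj, Cplus_conj, !RtoC_conj; reflexivity.
Qed.

Lemma T_s_conj (alpha tau xi : R) : T_s alpha tau (- xi) = Cconj (T_s alpha tau xi).
Proof.
  unfold T_s; rewrite Cdiv_conj_total, <- !Csin_conj, !Cmult_conj, !RtoC_conj.
  reflexivity.
Qed.

Theorem theorem9p4 (alpha : R) (Halpha : 0 < alpha < 1) :
  (* (a) existence and uniqueness of alpha_c, plus the final consequence *)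
  (exists ac : R,
      0 < ac < 1 /\
      (forall tau : R, 1 < tau < 2 ->
         (T_s alpha tau 0 = T_B alpha tau 0 <-> tau = 1 + ac)) /\
      (forall ac' : R,
         (forall tau : R, 1 < tau < 2 ->
            (T_s alpha tau 0 = T_B alpha tau 0 <-> tau = 1 + ac')) -> ac' = ac) /\
      (* consequence: unique solution (tau, xi) of T_s = T_B *)
      (forall tau xi : R, 1 < tau < 2 ->
         (T_s alpha tau xi = T_B alpha tau xi <-> (xi = 0 /\ tau = 1 + ac)))) /\
  (* (b) *)
  (forall tau xi : R, 1 / 4 <= xi -> 1 + alpha <= tau < 2 ->
     Cmod (T_s alpha tau xi) > Cmod (T_B alpha tau xi)) /\
  (* (c) *)
  (forall tau xi : R, 0 < xi < 1 / 4 -> 1 + alpha <= tau < 2 ->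
     Carg (T_s alpha tau xi) <> Carg (T_B alpha tau xi)) /\
  (* (d) *)
  (forall tau xi : R, 0 < xi -> 1 < tau < 1 + alpha ->
     Carg (T_s alpha tau xi) <> Carg (T_B alpha tau xi)).
Proof.
  split; [| split; [| split]].
  - destruct (real_solution_exists alpha Halpha) as [t [Ht Et]].
    assert (Hreal : forall tau, 1 < tau < 2 ->
      (T_s alpha tau 0 = T_B alpha tau 0 <-> tau = 1 + (t - 1))).
    { intros tau Htau; split.
      - intros E.
        rewrite (real_solution_unique alpha tau t Halpha Htau ltac:(lra) E Et); ring.
      - intros ->; now replace (1 + (t - 1)) with t by ring. }
    exists (t - 1); split; [lra | split; [exact Hreal | split]].
    + intros ac' H.
      (* The equivalence assumed for [ac'], taken at the known solution t, forces t = 1 + ac'. *)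
      assert (A := proj1 (H t ltac:(lra)) Et); lra.
    + intros tau xi Htau; split.
      * intros E.
        assert (Hxi : xi = 0).
        { destruct (Rtotal_order xi 0) as [H | [H | H]]; [exfalso | exact H | exfalso].
          - apply (T_s_T_B_arg_neq alpha tau (- xi) Halpha Htau ltac:(lra)).
            now rewrite T_s_conj, T_B_conj, E.
          - apply (T_s_T_B_arg_neq alpha tau xi Halpha Htau H); now rewrite E. }
        split; [exact Hxi |]; apply Hreal; [exact Htau | now rewrite <- Hxi].
      * intros [-> ->]; apply Hreal; [lra | reflexivity].
  - intros tau xi Hxi Ht; now apply T_s_mod_gt_T_B_mod.
  - intros tau xi Hxi Ht; apply T_s_T_B_arg_neq; lra.
  - intros tau xi Hxi Ht; apply T_s_T_B_arg_neq; lra.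
Qed.
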